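(* Let $M$ be a countable commutative monoid and let $M\curvearrowright X$ be a bounded-to-one Borel action on a standard Borel space $X$. Then the orbit equivalence relation $E_M^X$ is hyperfinite.
   Context: Monoids are commutative with identity, written additively; the action is written $mx$, so $0x=x$ and $(m+n)x=m(nx)$. The action is Borel if each map $x\mapsto mx$ on $X$ is Borel. It is bounded-to-one if for each $m\in M$ there is a finite $k_m$ such that every fiber of $x\mapsto mx$ has at most $k_m$ elements. No freeness is assumed. $E_M^X$ is the equivalence relation on $X$ generated by the pairs $(x,mx)$, $x\in X$, $m\in M$ (equivalently, since $M$ is commutative, $x\mathrel{E_M^X}y$ iff $ax=by$ for some $a,b\in M$). A Borel equivalence relation $E$ with countable classes on a standard Borel space is hyperfinite if $E=\bigcup_{n\in\mathbb N}E_n$ with $E_n\subseteq E_{n+1}$, where each $E_n$ is a Borel equivalence relation with finite classes. *)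

(* Defs.v *)
From mathcomp Require Import all_boot all_order all_algebra.
From mathcomp Require Import all_classical all_reals all_analysis.
From Stdlib Require Relation_Definitions Relation_Operators.

Set Implicit Arguments.
Unset Strict Implicit.
Unset Printing Implicit Defensive.

Import GRing.Theory.

Local Open Scope classical_set_scope.
Local Open Scope ring_scope.

Definition separable (T : topologicalType) : Prop :=
  exists2 D : set T, countable D & dense D.

(* [completeType] is pointed, hence excludes the empty space. *)
Definition complete_space (T : uniformType) : Prop :=
  forall F : set_system T, ProperFilter F -> cauchy F -> exists x : T, F --> x.

(* A measurable space is a plain type [X] with its system [B] of Borel sets,
   rather than a [measurableType], because the latter is pointed.
   [standard_borel R B] says that (X, B) is isomorphic, as a measurable space,
   to a complete separable metric space with its Borel sigma-algebra (which
   entails that [B] is a sigma-algebra); [R] is the type of real numbers in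
   which the metric takes its values. *)
Definition standard_borel (R : realType) (X : Type) (B : set (set X)) : Prop :=
  exists (T : metricType R) (f : X -> T),
    [/\ complete_space T, separable T, bijective f &
        B = preimage_set_system setT f <<s (@open T) >>].

Definition borel_map (X : Type) (B : set (set X)) (f : X -> X) : Prop :=
  forall A, B A -> B (f @^-1` A).

(* The Borel sets of X * X are those of the product sigma-algebra. *)
Definition borel_rel (X : Type) (B : set (set X)) (E : X -> X -> Prop) : Prop :=
  <<s [set A1 `*` A2 | A1 in B & A2 in B] >> [set p : X * X | E p.1 p.2].

Definition borel_equivalence (X : Type) (B : set (set X))
    (E : X -> X -> Prop) : Prop :=
  Relation_Definitions.equivalence X E /\ borel_rel B E.

Definition hyperfinite (X : Type) (B : set (set X)) (E : X -> X -> Prop)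
    : Prop :=
  [/\ borel_equivalence B E,
      forall x, countable [set y | E x y] &
      exists F : nat -> X -> X -> Prop,
        [/\ forall n, borel_equivalence B (F n),
            forall n x, finite_set [set y | F n x y],
            forall n x y, F n x y -> F n.+1 x y &
            forall x y, E x y <-> exists n, F n x y]].

Section Action.
Variables (M : nmodType) (X : Type) (act : M -> X -> X).

Definition monoid_action : Prop :=
  (forall x, act 0 x = x) /\
  (forall m n x, act (m + n) x = act m (act n x)).

Definition borel_action (B : set (set X)) : Prop :=
  forall m, borel_map B (act m).

Definition bounded_to_one : Prop :=
  forall m, exists k : nat, forall y, (act m @^-1` [set y] #<= `I_k)%card.

Definition orbit_equivalence : X -> X -> Prop :=
  Relation_Operators.clos_refl_sym_trans X (fun x y => exists m, y = act m x).

End Action.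

(* Main.v *)
Require Import Defs.
From mathcomp Require Import all_boot all_order all_algebra.
From mathcomp Require Import all_classical all_reals all_analysis.
From mathcomp Require Import zify lra.

(** Why the theorem is true.

    Write g_0, g_1, ... for an enumeration of M, and say that x and y are
    joined at level k within distance e when a x = b y for some combinations
    a and b of g_0, ..., g_(k-1) with coefficients at most e.  This relation
    behaves like a distance, two points are orbit equivalent exactly when they
    are joined for some k and e, and it suffices to find Borel maps
    G_n : X -> X such that

    - G_n x = a x with a taken in a finite subset of M that depends on n only,
    - any two orbit equivalent points have the same image under G_n for all
      large n.

    Indeed the relations [G_n x = G_n y for all n >= N] are then Borel and
    increase with N to the orbit equivalence relation, and their classes are
    finite because the action is finite-to-one
    ([orbit_equivalence_hyperfinite]).

    The map G_n is a composition c_(n,n) o ... o c_(n,1) o c_(n,0), where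
    c_(n,k) moves a point x forward to the centre of a ball that contains it,
    in a covering of X by balls of radius about r_k, the scales r_k growing
    fast.  At level k an orbit looks, in the forward direction, like a quotient
    of the k-dimensional grid, so the family of centres can be chosen such that
    x is near at most 8^k of them, whatever the scale ([good_scale_exists]).
    Each centre s has r_k + (gap) j as its radius, where j ranges over finitely
    many values and may depend on s and on n.  A neighbour y of x can be sent by
    c_(n,k) to another centre only if the sphere of some centre s near x passes
    close to x.  Let j be the rank of n among those levels n' > k at which
    the later stages c_(n',n') o ... o c_(n',k+1) still separate s from points
    near s.  Different such levels receive different radii, so each of the at
    most 8^k centres near x is responsible for at most one of them.  By
    descending induction on k, at most 8^k + 1 levels n separate x from its
    neighbours at scale k ([cut_count]); the bound at scale k + 1, which does
    not depend on r_(k+1), tells in advance how many radii are needed at scale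
    k.  This is where the lack of a bound on the number of generators of M is
    overcome: a fixed pair of points is affected by finitely many n only.

    Centres that can be seen going forward from x are obtained from a greedy
    maximal separated set.  The greedy procedure is run on grid positions
    rather than on points: the decision concerning the position of x is
    postponed until all the positions that matter for it lie ahead of x
    ([marked]).  It uses a finite Borel colouring in which distinct points
    a z and b z, with a and b small, get distinct colours
    ([finite_borel_coloring]).

    The colouring is the place where the action has to be bounded-to-one, in
    two ways: the graph to be coloured has bounded degree, and the images of
    Borel sets under x |-> m x are Borel ([standard_borel_image]).  The latter
    is a version of the theorem of Lusin and Souslin for maps whose fibres have
    at most k elements; it follows from the separation of k + 1 analytic sets
    with empty intersection by Borel sets with empty intersection. *)

Set Implicit Arguments.
Unset Strict Implicit.
Unset Printing Implicit Defensive.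

Import Order.TTheory GRing.Theory Num.Theory.

Local Open Scope classical_set_scope.

(** * Complete codings of standard Borel spaces *)

Definition eventually_holds (P : nat -> Prop) : Prop :=
  exists N0, forall N, (N0 <= N)%N -> P N.

Lemma eventually_holds2 (P Q : nat -> Prop) :
  eventually_holds P -> eventually_holds Q ->
  exists N, P N /\ Q N.
Proof.
move=> [n hn] [m hm]; exists (maxn n m).
by split; [apply: hn; rewrite leq_maxl|apply: hm; rewrite leq_maxr].
Qed.

Lemma eventually_holdsW (P Q : nat -> Prop) :
  (forall N, P N -> Q N) -> eventually_holds P -> eventually_holds Q.
Proof. by move=> PQ [n hn]; exists n => N /hn /PQ. Qed.

Section MetricCovers.
Variables (R : realType) (T : metricType R).
Local Open Scope ring_scope.

Definition inv_succ (n : nat) : R := n.+1%:R^-1.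

Lemma inv_succ_gt0 n : 0 < inv_succ n.
Proof. by rewrite invr_gt0. Qed.

Lemma inv_succ_small (e : R) : 0 < e -> exists n, inv_succ n < e.
Proof.
move=> e0; have [n _ hn] := near_infty_natSinv_lt (PosNum e0).
by exists n; apply: hn => /=.
Qed.

Definition seq_limit (y : nat -> T) (x : T) : Prop :=
  forall n, eventually_holds (fun N => mdist x (y N) < inv_succ n).

Lemma mdist_le_lim (e x : T) (c : R) (y : nat -> T) :
  seq_limit y x -> eventually_holds (fun N => mdist e (y N) <= c) ->
  mdist e x <= c.
Proof.
move=> yx ey; rewrite leNgt; apply/negP => cx.
have [n hn] : exists n, inv_succ n < mdist e x - c.
  by apply: inv_succ_small; rewrite subr_gt0.
have [N [h1 h2]] := eventually_holds2 (yx n) ey.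
have := metric_triangle e (y N) x; rewrite (metric_sym (y N) x).
lra.
Qed.

(** The second clause isolates what completeness needs of a family of covers: limits stay
    in the chosen members.  Closed covers satisfy it, but so do covers by
    complicated Borel sets once enough auxiliary covers are present. *)
Definition seq_closed_covers (C : nat -> nat -> set T) : Prop :=
  (forall n x, exists i, C n i x) /\
  (forall (z : nat -> nat) y x, seq_limit y x ->
    (forall n, eventually_holds (fun N => C n (z n) (y N))) ->
    forall n, C n (z n) x).

Local Notation borel_of_open := <<s (@open T) >>.

(** This plays the role of a finer complete topology in which [A] is clopen. *)
Definition decided_by_covers (A : set T) : Prop :=
  exists C : nat -> nat -> set T,
    [/\ seq_closed_covers C, forall n i, borel_of_open (C n i) &
        forall i, C 0%N i `<=` A \/ C 0%N i `<=` ~` A].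

Lemma decided_setC (A : set T) :
  decided_by_covers A -> decided_by_covers (~` A).
Proof.
move=> [C [h1 h2 h3]]; exists C; split => // i.
by rewrite setCK; case: (h3 i); [right|left].
Qed.

Lemma borel_of_open_sigma : sigma_algebra setT borel_of_open.
Proof. exact: smallest_sigma_algebra. Qed.

Lemma borel_of_openC A : borel_of_open A -> borel_of_open (~` A).
Proof. by move=> hA; rewrite -setTD; apply: (let: And3 _ h _ := borel_of_open_sigma in h). Qed.

Lemma borel_of_open_bigcup (A : nat -> set T) :
  (forall n, borel_of_open (A n)) -> borel_of_open (\bigcup_n A n).
Proof. by move=> hA; apply: (let: And3 _ _ h := borel_of_open_sigma in h). Qed.

(** The covers of all the [A j] are used together, preceded by the cover formed by
    the sets [A j] and the complement of their union.  A limit point lies in the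
    chosen member of this first cover because the other covers decide each
    [A j]. *)
Lemma decided_bigcup (A : nat -> set T) : (forall j, borel_of_open (A j)) ->
  (forall j, decided_by_covers (A j)) -> decided_by_covers (\bigcup_j A j).
Proof.
move=> bA /choice[C hC].
pose dec (l : nat) : nat * nat := odflt (0, 0)%N (unpickle l).
exists (fun n i => match n with
  | 0 => match i with 0 => ~` (\bigcup_j A j) | i.+1 => A i end
  | l.+1 => C (dec l).1 (dec l).2 i end); split.
- split=> [[|n] x|z y x yx hz].
  + have [[j _ hj]|h] := pselect ((\bigcup_j A j) x); first by exists j.+1.
    by exists 0%N.
  + by have [[+ _] _ _] := hC (dec n).1; apply.
  have sub j n : C j n (z (pickle (j, n)).+1) x.
    have [[_ +] _ _] := hC j.
    move=> /(_ (fun n => z (pickle (j, n)).+1) y x yx); apply => {}n.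
    by apply: eventually_holdsW (hz (pickle (j, n)).+1) => N; rewrite /dec pickleK.
  case=> [|n]; last first.
    have [[_ +] _ _] := hC (dec n).1.
    (* [n.+1] need not be the canonical index of its cover, hence the modified
       choice *)
    move=> /(_ (fun m => if m == (dec n).2 then z n.+1 else z (pickle ((dec n).1, m)).+1) y x yx).
    move=> /(_ _ (dec n).2); rewrite eqxx; apply => m /=.
    case: eqP => [->|_]; first exact: (hz n.+1).
    apply: eventually_holdsW (hz (pickle ((dec n).1, m)).+1) => N.
    by rewrite /dec pickleK.
  have := hz 0%N; case: (z 0%N) => [|j] h0.
    move=> [j _ Ajx].
    have [_ _ /(_ (z (pickle (j, 0%N)).+1))] := hC j; case => h.
      have [N [h1 h2]] := eventually_holds2 h0 (hz (pickle (j, 0%N)).+1).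
      by apply: h1; exists j => //; apply: h; rewrite /dec pickleK in h2.
    by apply: h (Ajx); apply: sub.
  have [_ _ /(_ (z (pickle (j, 0%N)).+1))] := hC j; case => h.
    by apply: h; apply: sub.
  have [N [h1 h2]] := eventually_holds2 h0 (hz (pickle (j, 0%N)).+1).
  by rewrite /dec pickleK /= in h2; have := h _ h2 h1.
- move=> [|n] [|i] //=.
  + by apply: borel_of_openC; apply: borel_of_open_bigcup.
  + by have [_ + _] := hC (dec n).1; apply.
  + by have [_ + _] := hC (dec n).1; apply.
- by move=> [|i]; [right|left => x Ax; exists i].
Qed.

Lemma closed_of_balls (A : set T) :
  (forall x, ~ A x -> exists n, forall p, mdist x p < inv_succ n -> ~ A p) ->
  borel_of_open A.
Proof.
move=> h; rewrite -(setCK A); apply: borel_of_openC; apply: sub_gen_smallest.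
rewrite openE => x /h[n hn]; rewrite /interior; apply/nbhs_ballP.
exists (inv_succ n); first exact: inv_succ_gt0.
by move=> p; rewrite ballEmdist; apply: hn.
Qed.

(** An open set is the union of the closed sets of points whose distance to the
    complement is at least [inv_succ m]. *)
Lemma decided_open (A : set T) : open A -> decided_by_covers A.
Proof.
move=> oA.
pose K m := [set x : T | forall p, mdist x p < inv_succ m -> A p].
have KA m : K m `<=` A by move=> x; apply; rewrite mdistxx inv_succ_gt0.
have AK x : A x -> exists m, K m x.
  move=> Ax; move: oA; rewrite openE => /(_ _ Ax) /nbhs_ballP[e /= e0 he].
  have [n hn] := inv_succ_small e0.
  exists n => p hp; apply: he; rewrite ballEmdist /=; exact: lt_trans hn.
exists (fun _ i => if i is m.+1 then K m else ~` A); split.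
- split=> [_ x|z y x yx hz n].
    have [/AK[m]|] := pselect (A x); first by exists m.+1.
    by exists 0%N.
  have := hz n; case: (z n) => [|m] h /=.
    move=> /AK[m Km]; have [N [h1 h2]] := eventually_holds2 h (yx m).
    by apply: h1; apply: Km.
  move=> p xp.
  have [k hk] : exists k, inv_succ k < inv_succ m - mdist x p.
    by apply: inv_succ_small; rewrite subr_gt0.
  have [N [h1 h2]] := eventually_holds2 h (yx k).
  apply: h1; have := metric_triangle (y N) x p; rewrite (metric_sym (y N) x).
  lra.
- move=> _ [|m]; first by apply: borel_of_openC; apply: sub_gen_smallest.
  apply: closed_of_balls => x /existsNP[p /not_implyP[xp nAp]].
  have [k hk] : exists k, inv_succ k < inv_succ m - mdist x p.
    by apply: inv_succ_small; rewrite subr_gt0.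
  exists k => q xq Kq; apply: nAp; apply: Kq.
  have := metric_triangle q x p; rewrite (metric_sym q x); lra.
- by move=> [|m]; [right|left].
Qed.

Lemma decided_borel (A : set T) : borel_of_open A -> decided_by_covers A.
Proof.
move=> hA; suff: [set S | borel_of_open S /\ decided_by_covers S] A by case.
move: A hA; apply: smallest_sub.
- split.
  + split; first by apply: (let: And3 h _ _ := borel_of_open_sigma in h).
    by rewrite -setCT; apply: decided_setC; apply: decided_open; exact: openT.
  + by move=> A [h1 h2]; rewrite setTD; split; [apply: borel_of_openC|apply: decided_setC].
  + move=> A hA; split; first by apply: borel_of_open_bigcup => n; have [] := hA n.
    by apply: decided_bigcup => n; have [] := hA n.
- by move=> A oA; split; [apply: sub_gen_smallest|apply: decided_open].
Qed.

Hypothesis T_complete : complete_space T.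
Variable e : nat -> T.
Hypothesis e_dense : forall x n, exists i, mdist (e i) x < inv_succ n.

Lemma cauchy_seq_limit (y : nat -> T) :
  (forall n, exists p, eventually_holds (fun N => mdist p (y N) <= inv_succ n)) ->
  exists x, seq_limit y x.
Proof.
move=> hy.
have cF : cauchy (y @ \oo).
  apply/cauchy_exP => eps eps0; have [n hn] := inv_succ_small eps0.
  have [p [N0 hp]] := hy n; exists p; exists N0 => // N /= /hp h.
  by rewrite ballEmdist /=; apply: le_lt_trans hn.
have [x /metricType_numDomainType.cvgrPdist_lt hx] := T_complete (fmap_proper_filter y _) cF.
exists x => n; have [N0 _ hN] := hx _ (inv_succ_gt0 n).
by exists N0 => N /hN.
Qed.

Definition rational_ball (n i : nat) : set T :=
  [set x | mdist (e i) x <= inv_succ n].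

Lemma borel_rational_ball n i : borel_of_open (rational_ball n i).
Proof.
apply: closed_of_balls => x /negP; rewrite -ltNge => hx.
have [k hk] : exists k, inv_succ k < mdist (e i) x - inv_succ n.
  by apply: inv_succ_small; rewrite subr_gt0.
exists k => p xp; apply/negP; rewrite -ltNge.
have := metric_triangle (e i) p x; rewrite (metric_sym p x); lra.
Qed.

Lemma rational_ball_sep x y :
  (forall n i, rational_ball n i x -> rational_ball n i y) -> x = y.
Proof.
move=> h; apply: mdist_positivity; apply/eqP.
rewrite eq_le mdist_ge0 andbT leNgt; apply/negP => xy.
have [n hn] : exists n, inv_succ n < mdist x y / 2.
  by apply: inv_succ_small; rewrite divr_gt0.
have [i hi] := e_dense x n.
have := h n i (ltW hi); rewrite /rational_ball /= => hy.
have := metric_triangle x (e i) y; rewrite (metric_sym x (e i)).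
lra.
Qed.

(** A code assigns to a point, for every [n], the index of its cell in a countable
    partition.  Completeness says that cells with nonempty finite intersections
    have a common point, so that the points of [X] correspond to the branches of
    a tree with no dead branch. *)
Definition complete_code (X : Type) (D : nat -> X -> nat) : Prop :=
  forall z : nat -> nat, (forall N, exists y, forall n, (n < N)%N -> D n y = z n) ->
    exists x, forall n, D n x = z n.

Definition decides (X : Type) (D : nat -> X -> nat) (A : set X) : Prop :=
  exists n, forall x y, D n x = D n y -> A x -> A y.

(** Every member of a cover that decides a Borel set is itself Borel, so it is in turn
    decided by further covers.  Closing up under this operation gives a countable
    family of covers that decides all its own members.  In such a family each
    cover can be replaced by the partition according to the first member that
    contains a point, without losing completeness. *)
Lemma metric_complete_code (A : nat -> set T) : (forall j, borel_of_open (A j)) ->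
  exists D : nat -> T -> nat,
    [/\ forall n i, borel_of_open [set x | D n x = i], complete_code D &
        forall j, decides D (A j)].
Proof.
move=> bA.
have /choice[Sch hSch] : forall S : set T, exists C : nat -> nat -> set T, borel_of_open S ->
    [/\ seq_closed_covers C, forall n i, borel_of_open (C n i) &
        forall i, C 0%N i `<=` S \/ C 0%N i `<=` ~` S].
  move=> S; have [/decided_borel[C hC]|nS] := pselect (borel_of_open S); first by exists C.
  by exists (fun _ _ => setT).
pose J : Type := (nat + nat * nat)%type.
pose base (j : J) := match j with inl j => A j | inr p => rational_ball p.1 p.2 end.
(* [As s j] runs over the sets obtained from the given ones and the balls by
   repeatedly passing to a member of a deciding cover. *)
pose fix As (s : seq (nat * nat)) (j : J) {struct s} : set T :=
  if s is p :: s' then Sch (As s' j) p.1 p.2 else base j.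
have bAs s j : borel_of_open (As s j).
  elim: s => [|[n i] s IH] /=.
    by case: j => [j|[n i]]; [exact: bA|exact: borel_rational_ball].
  by have [_ + _] := hSch _ IH; apply.
pose L : Type := (J * seq (nat * nat) * nat + nat)%type.
pose cov (l : L) i := match l with
  | inl (j, s, n) => As ((n, i) :: s) j
  | inr n => As [::] (inr (n, i)) end.
have covAs l i : exists s j, cov l i = As s j.
  by case: l => [[[j s] n]|n]; eexists; eexists.
pose lv k : L := odflt (inr 0%N) (unpickle k).
have lvK l : lv (pickle l) = l by rewrite /lv pickleK.
have covT l x : exists i, `[< cov l i x >].
  case: l => [[[j s] n]|n].
    have [[h _] _ _] := hSch _ (bAs s j); have [i hi] := h n x.
    by exists i; apply/asboolP.
  by have [i hi] := e_dense x n; exists i; apply/asboolP; exact: ltW.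
pose D k x := ex_minn (covT (lv k) x).
have DP k x : cov (lv k) (D k x) x /\
    forall i, (i < D k x)%N -> ~ cov (lv k) i x.
  rewrite /D; case: ex_minnP => i /asboolP h hm; split=> // i' ii' /asboolP /hm.
  by rewrite leqNgt ii'.
have DE k i : [set x | D k x = i] =
    cov (lv k) i `\` \bigcup_j (if (j < i)%N then cov (lv k) j else set0).
  apply/seteqP; split=> x /=.
    move=> <-; have [h1 h2] := DP k x; split=> // -[j _].
    by case: ltnP => // /h2.
  move=> [h1 h2]; have [h3 h4] := DP k x.
  case: (ltngtP (D k x) i) => // h; last by case: (h4 _ h).
  by case: h2; exists (D k x) => //; rewrite h.
have bcov l i : borel_of_open (cov l i) by have [s [j ->]] := covAs l i.
have b0 : borel_of_open set0 by apply: (let: And3 h _ _ := borel_of_open_sigma in h).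
exists D; split.
- move=> k i; rewrite DE -[_ `\` _]setCK setCD setUC; apply: borel_of_openC.
  rewrite -bigcup2E; apply: borel_of_open_bigcup => -[|[|n]] //=; last exact: borel_of_openC.
  by apply: borel_of_open_bigcup => j; case: ifP.
- move=> z /choice[y hy].
  have ev_cell n : eventually_holds (fun N => D n (y N) = z n).
    by exists n.+1 => N /hy.
  have ev_cov n : eventually_holds (fun N => cov (lv n) (z n) (y N)).
    by apply: eventually_holdsW (ev_cell n) => N <-; have [] := DP n (y N).
  have [x yx] : exists x, seq_limit y x.
    apply: cauchy_seq_limit => n; exists (e (z (pickle (inr n : L)))).
    by have := ev_cov (pickle (inr n : L)); rewrite lvK.
  exists x => n.
  have xcov m : cov (lv m) (z m) x.
    have := ev_cov m; case: (lv m) => [[[j s] k]|k] hk; last exact: mdist_le_lim yx hk.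
    have [[_ +] _ _] := hSch _ (bAs s j).
    move=> /(_ (fun k' => if k' == k then z m else z (pickle (inl (j, s, k') : L))) y x yx).
    move=> /(_ _ k); rewrite eqxx; apply => k' /=.
    case: eqP => [->|_]; first exact: hk.
    by have := ev_cov (pickle (inl (j, s, k') : L)); rewrite lvK.
  suff : [set x | D n x = z n] x by [].
  rewrite DE; split; first exact: xcov.
  move=> [i _]; case: ltnP => // iz xi.
  have [s [j E]] := covAs (lv n) i.
  pose m := pickle (inl (j, s, 0%N) : L).
  have cm : cov (lv m) (z m) = Sch (As s j) 0%N (z m) by rewrite lvK.
  have [_ _ /(_ (z m))] := hSch _ (bAs s j); rewrite -cm -E => -[] h.
    have [N [h1 h2]] := eventually_holds2 (ev_cell n) (ev_cov m).
    have [_ /(_ i)] := DP n (y N); rewrite h1 => /(_ iz) h3; exact: h3 (h _ h2).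
  exact: h _ (xcov m) xi.
- move=> j; pose m := pickle (inl (inl j, [::], 0%N) : L).
  exists m => x y xy Ax; have [hx _] := DP m x; have [hy _] := DP m y.
  move: hx hy; rewrite xy lvK /= => hx hy.
  have [_ _ /(_ (D m y))] := hSch _ (bA j); case => h; first exact: (h _ hy).
  by case: (h _ hx).
Qed.

End MetricCovers.

Section StandardBorel.
Variables (R : realType) (X : Type) (B : set (set X)).
Hypothesis hX : standard_borel R B.

Lemma standard_borel_sigma_algebra : sigma_algebra setT B.
Proof.
have [T [f [_ _ _ ->]]] := hX; apply: sigma_algebra_preimage.
exact: smallest_sigma_algebra.
Qed.

Lemma standard_borel_code :
  (exists V : nat -> set X, (forall j, B (V j)) /\
     forall x y, (forall j, V j x -> V j y) -> x = y) /\
  (forall A : nat -> set X, (forall j, B (A j)) ->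
     exists D : nat -> X -> nat,
     [/\ forall n i, B [set x | D n x = i], complete_code D &
         forall j, decides D (A j)]).
Proof.
have [T [f [Tc [Q Qc Qd] [g fK gK] BE]]] := hX.
(* The empty space is treated apart, since it has no dense sequence. *)
have [[x0 _]|X0] := pselect (exists x : X, True); last first.
  split.
    exists (fun _ => set0); split; last by move=> x; case: X0; exists x.
    by move=> _; have [] := standard_borel_sigma_algebra.
  move=> A hA; exists (fun _ _ => 0%N); split.
  - move=> n i; suff -> : [set _ : X | 0%N = i] = set0.
      by have [] := standard_borel_sigma_algebra.
    by apply/seteqP; split => x; case: X0; exists x.
  - by move=> z /(_ 0%N)[y _]; case: X0; exists y.
  - by move=> j; exists 0%N => x; case: X0; exists x.
have BP S : (<<s (@open T) >>) S -> B (f @^-1` S).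
  by move=> hS; rewrite BE; exists S => //; rewrite setTI.
have [e he] : exists e : nat -> T, forall q, Q q -> exists i, e i = q.
  have [Q0|/set0P[q0 _]] := eqVneq Q set0.
    by exists (fun=> f x0) => q; rewrite Q0.
  have /countable_injP[k kinj] := Qc.
  (* any value will do outside the range of the injection *)
  exists (fun n => if pselect (exists q, Q q /\ k q = n) is left E
     then projT1 (cid E) else f x0) => q Qq; exists (k q).
  case: pselect => [E|[]]; last by exists q.
  case: (cid E) => q' /= [Qq' kq]; apply: kinj => //; exact: mem_set.
have hd x n : exists i, (mdist (e i) x < inv_succ R n)%R.
  have [q [xq Qq]] : (ball x (inv_succ R n))^° `&` Q !=set0.
    apply: Qd; last exact: open_interior.
    by exists x; apply: nbhsx_ballx; exact: inv_succ_gt0.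
  have [i iq] := he _ Qq; exists i; rewrite metric_sym iq.
  by have := interior_subset xq; rewrite ballEmdist.
split.
  exists (fun j => let p := odflt (0, 0)%N (unpickle j) in
    f @^-1` (rational_ball e p.1 p.2)); split.
    by move=> j; apply: BP; exact: borel_rational_ball.
  move=> x y h; rewrite -(fK x) -(fK y); congr (g _).
  apply: (rational_ball_sep hd) => n i.
  by have := h (pickle (n, i)); rewrite pickleK.
move=> A hA.
have /choice[S hS] : forall j, exists S, (<<s (@open T) >>) S /\ A j = f @^-1` S.
  by move=> j; have := hA j; rewrite BE => -[S ? <-]; exists S; rewrite setTI.
have [D [h1 h2 h3]] := metric_complete_code Tc hd (fun j => (hS j).1).
exists (fun n x => D n (f x)); split.
- by move=> n i; have := BP _ (h1 n i).
- move=> z hz; have [|x hx] := h2 z; last by exists (g x) => n; rewrite gK.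
  by move=> N; have [y hy] := hz N; exists (f y).
- move=> j; have [n hn] := h3 j; exists n => x y xy.
  by rewrite (hS j).2; exact: hn.
Qed.

End StandardBorel.

(** * Images of Borel sets under bounded-to-one maps *)

Section BorelCalculus.
Variables (X : Type) (B : set (set X)).
Hypothesis hB : sigma_algebra setT B.

Lemma borel_not (P : X -> Prop) : B [set x | P x] -> B [set x | ~ P x].
Proof. by have [_ h _] := hB; move=> /h; rewrite setTD. Qed.

Lemma borel_const (p : Prop) : B [set _ | p].
Proof.
have b0 : B set0 by case: hB.
have [hp|hp] := pselect p.
  have -> : [set _ : X | p] = [set x | ~ set0 x] by apply/seteqP; split=> x //= _ [].
  exact: (borel_not b0).
by have -> : [set _ : X | p] = set0 by apply/seteqP; split=> x.
Qed.

Lemma borel0 : B set0. Proof. by case: hB. Qed.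

Lemma borelT : B setT.
Proof. by have -> : [set: X] = [set _ | True] by []; apply: borel_const. Qed.

Lemma borel_exists (I : countType) (P : I -> X -> Prop) :
  (forall i, B [set x | P i x]) -> B [set x | exists i, P i x].
Proof.
move=> h; pose A n := if unpickle n is Some i then [set x | P i x] else set0.
suff -> : [set x | exists i, P i x] = \bigcup_n A n.
  case: hB => b0 _; apply=> n; rewrite /A; case: unpickle => // i; exact: h.
apply/seteqP; split=> x /=.
  by move=> [i hi]; exists (pickle i) => //; rewrite /A pickleK.
by move=> [n _]; rewrite /A; case: unpickle => // i hi; exists i.
Qed.

Lemma borel_forall (I : countType) (P : I -> X -> Prop) :
  (forall i, B [set x | P i x]) -> B [set x | forall i, P i x].
Proof.
move=> h.
suff -> : [set x | forall i, P i x] = [set x | ~ exists i, ~ P i x].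
  by apply: borel_not; apply: borel_exists => i; apply: borel_not.
by apply/seteqP; split=> x /=; [move=> hx [i]; apply|move=> /forallNP hx i; apply: contrapT].
Qed.

Lemma borel_or (P Q : X -> Prop) :
  B [set x | P x] -> B [set x | Q x] -> B [set x | P x \/ Q x].
Proof.
move=> hP hQ.
suff -> : [set x | P x \/ Q x] = [set x | exists b : bool, if b then P x else Q x].
  by apply: borel_exists => -[].
apply/seteqP; split=> x /=; first by case; [exists true|exists false].
by move=> [[]]; [left|right].
Qed.

Lemma borel_and (P Q : X -> Prop) :
  B [set x | P x] -> B [set x | Q x] -> B [set x | P x /\ Q x].
Proof.
move=> hP hQ.
suff -> : [set x | P x /\ Q x] = [set x | forall b : bool, if b then P x else Q x].
  by apply: borel_forall => -[].
apply/seteqP; split=> x /=; first by move=> [? ?] [].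
by move=> h; split; [apply: (h true)|apply: (h false)].
Qed.

Lemma borel_imply (P Q : X -> Prop) :
  B [set x | P x] -> B [set x | Q x] -> B [set x | P x -> Q x].
Proof.
move=> hP hQ.
suff -> : [set x | P x -> Q x] = [set x | ~ P x \/ Q x].
  by apply: borel_or => //; apply: borel_not.
apply/seteqP; split=> x /=; last by case=> [np /np|q _].
by move=> h; have [/h|] := pselect (P x); [right|left].
Qed.

Lemma borel_ext (P Q : X -> Prop) : (forall x, P x <-> Q x) ->
  B [set x | P x] -> B [set x | Q x].
Proof. by move=> h; suff -> : [set x | P x] = [set x | Q x] by []; apply/seteqP; split=> x /h. Qed.

End BorelCalculus.

Definition separates_points (X : Type) (V : nat -> set X) : Prop :=
  forall x y, (forall j, V j x -> V j y) -> x = y.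

Lemma separates_pointsP (X : Type) (V : nat -> set X) : separates_points V ->
  forall x y, x <> y -> exists j, V j x /\ ~ V j y.
Proof.
move=> h x y xy; apply: contrapT => /forallNP hn; apply: xy; apply: h => j Vx.
by apply: contrapT => nV; apply: (hn j).
Qed.

Section BorelMaps.
Variables (X : Type) (B : set (set X)).
Hypothesis hB : sigma_algebra setT B.
Variable V : nat -> set X.
Hypotheses (bV : forall j, B (V j)) (sepV : separates_points V).

Lemma borel_map_eq (f g : X -> X) : borel_map B f -> borel_map B g ->
  B [set x | f x = g x].
Proof.
move=> hf hg.
apply: (@borel_ext _ _ (fun x => forall j, V j (f x) -> V j (g x))).
  by move=> x; split; [exact: sepV|move=> ->].
by apply: borel_forall => // j; apply: borel_imply => //; [exact: hf|exact: hg].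
Qed.

End BorelMaps.

(** A duplicate-free list of maximal length enumerates the whole set. *)
Lemma bounded_uniq_enum (T : eqType) (P : T -> Prop) (k : nat) :
  (forall l : seq T, uniq l -> (forall a, a \in l -> P a) -> (size l <= k)%N) ->
  exists l : seq T, forall a, P a -> a \in l.
Proof.
move=> h.
pose Q n := `[< exists l : seq T, [/\ uniq l, forall a, a \in l -> P a & size l = n] >].
have exQ : exists n, Q n by exists 0%N; apply/asboolP; exists [::].
have ubQ n : Q n -> (n <= k)%N by move=> /asboolP[l [ul lP <-]]; exact: h.
have [n /asboolP[l [ul lP sl]] nmax] := ex_maxnP exQ ubQ.
exists l => a Pa; apply: contrapT => /negP al.
suff /nmax : Q n.+1 by rewrite ltnn.
apply/asboolP; exists (a :: l); split; rewrite /= ?sl //; first by rewrite al.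
by move=> b; rewrite inE => /orP[/eqP ->|/lP].
Qed.

Section Image.
Variables (X : Type) (B : set (set X)).
Hypothesis hB : sigma_algebra setT B.
Variable V : nat -> set X.
Hypotheses (bV : forall j, B (V j)) (sepV : separates_points V).
Variables (f : X -> X) (k : nat) (A : set X).
Hypothesis fiber_le : forall y, exists2 c : X -> nat,
  (forall x, f x = y -> (c x < k)%N) &
  (forall x x', f x = y -> f x' = y -> c x = c x' -> x = x').
Variable D : nat -> X -> nat.
Hypotheses (cD : complete_code D) (dA : decides D A)
  (dV : forall j, decides D (f @^-1` (V j))).

Lemma fiber_collision (g : 'I_k.+1 -> X) : injective g ->
  exists i j, f (g i) <> f (g j).
Proof.
move=> gi; apply: contrapT => h.
have fg i : f (g i) = f (g ord0).
  by apply: contrapT => ne; apply: h; exists i, ord0.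
have [c cS cI] := fiber_le (f (g ord0)).
have /leq_card : injective (fun i => Ordinal (cS _ (fg i))).
  by move=> i j [] /(cI _ _ (fg i) (fg j)) /gi.
by rewrite !card_ord ltnn.
Qed.

(** The part of [A] that corresponds to the node [z 0, ..., z (n - 1)] of the tree of
    codes. *)
Definition cell (n : nat) (z : nat -> nat) : set X :=
  [set x | A x /\ forall m, (m < n)%N -> D m x = z m].

(** Novikov's form of separation; for two nodes the sets [W i] are disjoint, as in Lusin's
    theorem. *)
Definition separated (n : nat) (t : 'I_k.+1 -> nat -> nat) : Prop :=
  exists W : 'I_k.+1 -> set X,
    [/\ forall i, B (W i), forall i x, cell n (t i) x -> W i (f x) &
        ~ exists y, forall i, W i y].

Definition extend (n : nat) (z : nat -> nat) (a : nat) : nat -> nat :=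
  fun m => if m == n then a else z m.

(** If every choice of immediate successors can be separated then so can the nodes:
    the witnesses are combined by unions over the successor of each node and
    intersections over the successors of the others. *)
Lemma separated_step n (t : 'I_k.+1 -> nat -> nat) :
  (forall a : {ffun 'I_k.+1 -> nat}, separated n.+1 (fun i => extend n (t i) (a i))) ->
  separated n t.
Proof.
move=> /choice[W hW].
exists (fun i => [set y | exists m, forall a : {ffun 'I_k.+1 -> nat}, a i = m -> W a i y]).
split.
- move=> i; apply: borel_exists => // m; apply: borel_forall => // a.
  by apply: borel_imply => //; [exact: borel_const|have [h _ _] := hW a; exact: h].
- move=> i x [Ax hx]; exists (D n x) => a ai; have [_ h _] := hW a; apply: h.
  split=> // m; rewrite ltnS leq_eqVlt /extend => /orP[/eqP ->|mn].
    by rewrite eqxx.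
  by rewrite ltn_eqF //; exact: hx.
- move=> [y /choice[m hm]]; have [_ _] := hW [ffun i => m i]; apply; exists y => i.
  by apply: hm; rewrite ffunE.
Qed.

(** Otherwise one could extend the nodes forever without ever separating them.  By
    completeness the branches obtained are the codes of [k.+1] distinct points,
    two of which have distinct images; a set [V v] that distinguishes these
    images then separates the nodes at a finite stage. *)
Lemma separated_distinct n (t : 'I_k.+1 -> nat -> nat) :
  (forall i j, i <> j -> exists m, (m < n)%N /\ t i m <> t j m) ->
  separated n t.
Proof.
move=> tne; apply: contrapT => nt.
have /choice[ch hch] : forall p : nat * ('I_k.+1 -> nat -> nat), exists a : {ffun 'I_k.+1 -> nat},
    ~ separated p.1 p.2 -> ~ separated p.1.+1 (fun i => extend p.1 (p.2 i) (a i)).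
  move=> [m u] /=; have [h|] := pselect (separated m u); first by exists [ffun=> 0%N].
  move=> nu; apply: contrapT => /forallNP h; apply: nu; apply: separated_step => a.
  by apply: contrapT => na; apply: (h a).
pose S := fix S d : 'I_k.+1 -> nat -> nat := if d is d'.+1 then
  (fun i => extend (n + d') (S d' i) (ch ((n + d')%N, S d') i)) else t.
have nS d : ~ separated (n + d) (S d).
  by elim: d => [|d IH]; rewrite ?addn0 // addnS; apply: (hch ((n + d)%N, S d)).
have Sstab d e i m : (m < n + d)%N -> S (d + e)%N i m = S d i m.
  move=> md; elim: e => [|e IH]; first by rewrite addn0.
  by rewrite addnS /= /extend ltn_eqF ?IH // (leq_trans md) // leq_add2l leq_addr.
pose z i m := S m.+1 i m.
have zS d i m : (m < n + d)%N -> z i m = S d i m.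
  move=> md; rewrite /z -(Sstab m.+1 d) ?addnS ?ltnS ?leq_addl // -?addnS -?addSn.
  by rewrite addnC (Sstab d m.+1).
have cz d i : cell (n + d) (S d i) = cell (n + d) (z i).
  by apply/seteqP; split=> x [Ax hx]; split=> // m md; rewrite hx // (zS d).
have nonempty d i : exists x, cell (n + d) (z i) x.
  apply: contrapT => /forallNP h; apply: (nS d).
  exists (fun j => if j == i then set0 else setT); split.
  - by move=> j; case: ifP => _; [exact: (borel0 hB)|exact: (borelT hB)].
  - by move=> j x; case: eqP => // ->; rewrite cz => /h.
  - by move=> [y /(_ i)]; rewrite eqxx.
have /choice[g hg] : forall i, exists x, A x /\ forall m, D m x = z i m.
  move=> i; have [|x hx] := cD (z := z i).
    move=> N; have [y [_ hy]] := nonempty N i; exists y => m mN; apply: hy.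
    by rewrite (leq_trans mN) // leq_addl.
  exists x; split=> //; have [l hl] := dA.
  have [y [Ay hy]] := nonempty l.+1 i; apply: hl Ay.
  by rewrite hx; apply: hy; rewrite addnS ltnS leq_addl.
have gi : injective g.
  move=> i j gij; apply: contrapT => /tne[m [mn]]; apply.
  have := zS 0%N i m; rewrite addn0 => /(_ mn) /= <-.
  have := zS 0%N j m; rewrite addn0 => /(_ mn) /= <-.
  by rewrite -(hg i).2 -(hg j).2 gij.
have [i [j fij]] := fiber_collision gi.
have [v [vi vj]] := separates_pointsP sepV fij.
have [l hl] := dV v.
apply: (nS l.+1).
exists (fun i' => if i' == i then V v else if i' == j then ~` V v else setT); split.
- move=> i'; case: ifP => // _; case: ifP => _; first exact: (borel_not hB (bV v)).
  exact: (borelT hB).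
- move=> i' x; rewrite cz; case: eqP => [->|_] [_ hx].
    apply: (hl (g i)) => //; rewrite (hg i).2 hx //.
    by rewrite addnS ltnS leq_addl.
  case: eqP hx => // -> hx vx; apply: vj; apply: (hl x) => //.
  by rewrite (hg j).2 hx // addnS ltnS leq_addl.
- move=> [y hy]; have := hy j; have := hy i; rewrite !eqxx.
  by case: eqP => // ji; case: fij; rewrite ji.
Qed.

(** Intersecting the separating sets over all the tuples in which a node occurs gives
    for each node a Borel set around its image, such that every point lies in the
    hulls of at most [k] nodes of each length.  The hulls are also kept so small
    that only the image itself survives along a branch. *)
Lemma borel_cell_hulls : exists H : seq nat -> set X,
  [/\ forall s, B (H s),
      forall s x, cell (size s) (nth 0%N s) x -> H s (f x),
      forall s y, H s y -> cell (size s) (nth 0%N s) !=set0 /\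
        forall j, (forall x, cell (size s) (nth 0%N s) x -> V j (f x)) -> V j y &
      forall (t : 'I_k.+1 -> seq nat) n y, injective t -> (forall i, size (t i) = n) ->
        ~ forall i, H (t i) y].
Proof.
have /choice[W hW] : forall t : {ffun 'I_k.+1 -> seq nat}, exists W : 'I_k.+1 -> set X,
    injective t -> (forall i, size (t i) = size (t ord0)) ->
    [/\ forall i, B (W i),
        forall i x, cell (size (t i)) (nth 0%N (t i)) x -> W i (f x) &
        ~ exists y, forall i, W i y].
  move=> t; have [[ti ts]|nt] :=
      pselect (injective t /\ (forall i, size (t i) = size (t ord0))); last first.
    by exists (fun=> setT) => ti ts; case: nt.
  have [|W [h1 h2 h3]] := @separated_distinct (size (t ord0)) (fun i => nth 0%N (t i)).
    move=> i j ij; apply: contrapT => /forallNP h; apply: ij; apply: ti.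
    apply: (@eq_from_nth _ 0%N); first by rewrite !ts.
    by move=> m; rewrite ts => mt; apply: contrapT => ne; apply: (h m).
  by exists W => _ _; split=> // i x; rewrite ts; exact: h2.
pose nice (t : {ffun 'I_k.+1 -> seq nat}) :=
  injective t /\ (forall i, size (t i) = size (t ord0)).
exists (fun s => [set y | (cell (size s) (nth 0%N s) !=set0 /\
  forall j, (forall x, cell (size s) (nth 0%N s) x -> V j (f x)) -> V j y) /\
  forall (t : {ffun 'I_k.+1 -> seq nat}) i, nice t /\ t i = s -> W t i y]).
split.
- move=> s /=; apply: (borel_and hB).
    apply: (borel_and hB); first exact: borel_const.
    apply: (borel_forall hB) => j; apply: (borel_imply hB); last exact: bV.
    exact: borel_const.
  apply: (borel_forall hB) => t; apply: (borel_forall hB) => i.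
  have [[[ti ts] tis]|nt] := pselect (nice t /\ t i = s).
    apply: (borel_imply hB); first exact: borel_const.
    by have [h _ _] := hW _ ti ts; exact: h.
  apply: (@borel_ext _ _ (fun=> True)) => //; exact: borel_const.
- move=> s x hx; split; first by split; [exists x|move=> j; apply].
  move=> t i [[ti ts] tis]; have [_ h _] := hW _ ti ts; apply: h.
  by rewrite tis.
- by move=> s y [].
- move=> t n y ti ts hy; pose t' : {ffun 'I_k.+1 -> seq nat} := [ffun i => t i].
  have ti' : injective t' by move=> i j; rewrite !ffunE => /ti.
  have ts' i : size (t' i) = size (t' ord0) by rewrite !ffunE !ts.
  have [_ _ []] := hW _ ti' ts'; exists y => i.
  by have [_] := hy i; apply; split=> //; rewrite ffunE.
Qed.

(** The nodes all of whose initial segments have [y] in their hulls form a finitely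
    branching tree.  If it has nodes of every length, it has an infinite branch,
    which is the code of a point of [A] mapped to [y]; so membership in the image
    is expressed by quantifiers over integers and finite sequences. *)
Lemma borel_image_of_code : B (f @` A).
Proof.
have [H [bH HP HV Hk]] := borel_cell_hulls.
pose tree y s := forall m, H (take m s) y.
suff -> : f @` A = [set y | forall n, exists s : seq nat, size s = n /\ tree y s].
  apply: (borel_forall hB) => n; apply: (borel_exists hB) => s.
  apply: (borel_and hB); first exact: borel_const.
  by apply: (borel_forall hB) => m; exact: bH.
apply/seteqP; split=> y /=.
  move=> [x Ax <-] n; exists (mkseq (D^~ x) n); rewrite size_mkseq; split=> // m.
  apply: HP; split=> // i; rewrite size_take_min size_mkseq leq_min => /andP[im iN].
  by rewrite nth_take // nth_mkseq.
move=> hy.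
have tree_take s m : tree y s -> tree y (take m s).
  by move=> hs i; rewrite -take_min; exact: hs.
(* The infinite branch goes through nodes with descendants of every length. *)
pose ext s := forall n, (size s <= n)%N ->
  exists s', [/\ tree y s', size s' = n & take (size s) s' = s].
have ext0 : ext [::] by move=> n _; have [s [sn ts]] := hy n; exists s; rewrite take0.
have step s : exists a, ext s -> ext (rcons s a).
  have [es|ne] := pselect (ext s); last by exists 0%N.
  apply: contrapT => /forallNP h.
  have /choice[nn hnn] : forall a, exists n, (size s < n)%N /\
      forall s', ~ [/\ tree y s', size s' = n & take (size s).+1 s' = rcons s a].
    move=> a; have /not_implyP[_ /existsNP[n /not_implyP[sn]]] := h a.
    by rewrite size_rcons in sn *; move=> /forallNP hn; exists n.
  have [l hl] : exists l : seq nat, forall a, tree y (rcons s a) -> a \in l.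
    apply: (@bounded_uniq_enum _ _ k) => l ul lT; rewrite leqNgt; apply/negP => kl.
    apply: (Hk (fun i : 'I_k.+1 => rcons s (nth 0%N l i)) (size s).+1 y).
    - move=> i j /rcons_inj[] /eqP; rewrite nth_uniq ?(leq_trans (ltn_ord _)) //.
      by move=> /eqP /val_inj.
    - by move=> i; rewrite size_rcons.
    - move=> i; rewrite -[rcons _ _]take_size; apply: lT; apply: mem_nth.
      by rewrite (leq_trans (ltn_ord _)).
  pose N := (size s).+1 + \max_(a <- l) nn a.
  have [|s' [ts' ss' sE]] := es N; first by rewrite /N addSn -addnS leq_addr.
  pose a := nth 0%N s' (size s).
  have sN : (size s < N)%N by rewrite /N leq_addr.
  have sa : take (size s).+1 s' = rcons s a.
    by rewrite (take_nth 0%N) ?ss' // sE.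
  have [sna hna] := hnn a; apply: (hna (take (nn a) s')); split.
  - exact: tree_take.
  - rewrite size_takel // ss' /N -[leqLHS]add0n leq_add //.
    by apply: leq_bigmax_seq => //; apply: hl; rewrite -sa; exact: tree_take.
  - by rewrite take_takel.
have [ch hch] := choice step.
pose S := fix S n : seq nat := if n is n'.+1 then rcons (S n') (ch (S n')) else [::].
pose z n := ch (S n).
have SE n : S n = mkseq z n by elim: n => [|n IH] //; rewrite mkseqS -IH.
have extS n : ext (S n) by elim: n => //= n; exact: hch.
have HS n : H (S n) y.
  have [s' [ts' _ <-]] := extS n _ (leqnn _); exact: ts'.
have cS n x : cell (size (S n)) (nth 0%N (S n)) x <-> cell n z x.
  rewrite SE size_mkseq; split=> -[Ax hx]; split=> // m mn.
    by rewrite hx // nth_mkseq.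
  by rewrite nth_mkseq // hx.
have [|x hx] := cD (z := z).
  by move=> n; have [[x /cS[_ hx]] _] := HV _ _ (HS n); exists x.
exists x.
  have [l hl] := dA; have [[x' /cS[Ax' hx']] _] := HV _ _ (HS l.+1).
  by apply: hl Ax'; rewrite hx hx'.
apply: contrapT => /(separates_pointsP sepV)[v [vx]]; apply.
have [l hl] := dV v; have [_] := HV _ _ (HS l.+1); apply=> x' /cS[_ hx'].
by apply: (hl x) => //; rewrite hx hx'.
Qed.

End Image.

Lemma fiber_code_of_card (X : Type) (f : X -> X) (k : nat) (y : X) :
  (f @^-1` [set y] #<= `I_k)%card ->
  exists2 c : X -> nat, (forall x, f x = y -> (c x < k)%N) &
    (forall x x', f x = y -> f x' = y -> c x = c x' -> x = x').
Proof.
move=> /pcard_leP[c]; exists c.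
  by move=> x fx; have := @funS _ _ _ _ c x fx.
move=> x x' fx fx'; apply: (@inj _ _ _ c); exact: mem_set.
Qed.

Theorem standard_borel_image (R : realType) (X : Type) (B : set (set X))
    (f : X -> X) (k : nat) (A : set X) : standard_borel R B -> borel_map B f ->
  (forall y, (f @^-1` [set y] #<= `I_k)%card) -> B A -> B (f @` A).
Proof.
move=> hX bf fk bA; have [[V [bV sepV]] codes] := standard_borel_code hX.
have [|D [_ cD dD]] := codes (fun j => if j is j.+1 then f @^-1` (V j) else A).
  by case=> // j; exact: bf.
apply: (@borel_image_of_code _ _ (standard_borel_sigma_algebra hX) V bV sepV
  f k A _ D cD (dD 0%N) (fun j => dD j.+1)).
by move=> y; exact: fiber_code_of_card.
Qed.

(** * Finite Borel colourings *)

Definition enumerated (X : Type) (n : nat) (P : X -> Prop) : Prop :=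
  exists e : nat -> X, forall x, P x -> exists i, (i < n)%N /\ e i = x.

Lemma enumerated_inj (X : Type) (n c : nat) (P : X -> Prop) (g : nat -> X) :
  enumerated n P -> (forall i, (i < c)%N -> P (g i)) ->
  (forall i j, (i < c)%N -> (j < c)%N -> g i = g j -> i = j) -> (c <= n)%N.
Proof.
move=> [e he] gP gI.
have /choice[h hh] : forall i : 'I_c, exists j : 'I_n, e j = g i.
  by move=> i; have [j [jn <-]] := he _ (gP _ (ltn_ord i)); exists (Ordinal jn).
have /leq_card : injective h.
  move=> i j hij; apply: val_inj; apply: (gI _ _ (ltn_ord i) (ltn_ord j)).
  by rewrite -(hh i) -(hh j) hij.
by rewrite !card_ord.
Qed.

(** What the combinatorial part of the proof uses of a bounded-to-one Borel action on a
    standard Borel space. *)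
Record borel_system (M : countNmodType) (X : Type) (B : set (set X))
    (act : M -> X -> X) (V : nat -> set X) : Prop := BorelSystem {
  bs_sigma : sigma_algebra setT B;
  bs_V : forall j, B (V j);
  bs_sep : separates_points V;
  bs_act : monoid_action act;
  bs_borel : borel_action act B;
  bs_image : forall m A, B A -> B (act m @` A);
  bs_fiber : forall m, exists k : nat, forall y, exists2 c : X -> nat,
    (forall x, act m x = y -> (c x < k)%N) &
    (forall x x', act m x = y -> act m x' = y -> c x = c x' -> x = x') }.

Section Coloring.
Variables (M : countNmodType) (X : Type) (B : set (set X)) (act : M -> X -> X).
Variable V : nat -> set X.
Hypothesis S : borel_system B act V.
Let hB := bs_sigma S.
Variable L : seq M.

(** The union of the neighbourhoods of the points of [Q] in the graph that relates [a z]
    and [b z] for [a] and [b] in [L]. *)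
Definition nbr (Q : set X) (p : X) : Prop :=
  exists a b, a \in L /\ b \in L /\ exists z, act a z = p /\ Q (act b z).

Lemma borel_nbr (Q : set X) : B Q -> B [set p | nbr Q p].
Proof.
move=> bQ; apply: (borel_exists hB) => a; apply: (borel_exists hB) => b.
apply: (borel_and hB); first exact: borel_const.
apply: (borel_and hB); first exact: borel_const.
apply: (@borel_ext _ _ (act a @` (act b @^-1` Q))).
  by move=> p; split=> [[z Qz zp]|[z [zp Qz]]]; exists z.
by apply: (bs_image S); apply: (bs_borel S).
Qed.

(** A neighbour [b z] of [p = a z] is determined by [a], [b] and the index of [z] in the
    fibre of [p], of which there are boundedly many. *)
Lemma nbr_enumerated : exists n, forall p, enumerated n (fun q => nbr [set q] p).
Proof.
have [K hK] : exists K, forall a, a \in L -> forall y, exists2 c : X -> nat,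
    (forall x, act a x = y -> (c x < K)%N) &
    (forall x x', act a x = y -> act a x' = y -> c x = c x' -> x = x').
  have [k hk] := choice (bs_fiber S).
  exists (\max_(a <- L) k a) => a aL y; have [c c1 c2] := hk a y.
  exists c => // x /c1 h; apply: (leq_trans h).
  exact: leq_bigmax_seq.
pose Tr := [seq (p, i) | p <- [seq (a, b) | a <- L, b <- L], i <- iota 0 K].
exists (size Tr) => p.
have /choice[c hc] : forall a, exists c : X -> nat, a \in L ->
    (forall x, act a x = p -> (c x < K)%N) /\
    (forall x x', act a x = p -> act a x' = p -> c x = c x' -> x = x').
  move=> a; have [aL|] := boolP (a \in L); last by exists (fun=> 0%N).
  by have [c c1 c2] := hK a aL p; exists c.
have /choice[e he] : forall n, exists q, forall a b i z,
    nth (0, 0, 0%N)%R Tr n = (a, b, i) -> a \in L ->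
    act a z = p -> c a z = i -> q = act b z.
  move=> n; case E: (nth _ _ n) => [[a b] i].
  have [[z [aL zp zi]]|nz] :=
      pselect (exists z, [/\ a \in L, act a z = p & c a z = i]); last first.
    by exists p => a' b' i' z [<- <- <-] aL zp zi; case: nz; exists z.
  exists (act b z) => a' b' i' z' [<- <- <-] _ zp' zi'.
  by congr act; apply: (hc a aL).2; rewrite // zi.
exists e => q [a [b [aL [bL [z [zp <-]]]]]].
have tr : (a, b, c a z) \in Tr.
  apply/allpairsP; exists ((a, b), c a z); split => //.
    by apply/allpairsP; exists (a, b).
  by rewrite mem_iota /= add0n; apply: (hc a aL).1.
exists (index (a, b, c a z) Tr); rewrite index_mem; split=> //.
by apply: (he _ a b (c a z)) => //; rewrite nth_index.
Qed.

(** The points that are alone with respect to their neighbours in a given finite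
    intersection of the sets [V j].  Every point belongs to such a piece, because
    it has finitely many neighbours. *)
Definition indep_piece (s : seq nat) : set X :=
  [set p | (forall j, j \in s -> V j p) /\
    forall l, V l p -> ~ nbr [set q | (forall j, j \in s -> V j q) /\ ~ V l q] p].

Lemma borel_indep_piece s : B (indep_piece s).
Proof.
have hs : B [set p | forall j, j \in s -> V j p].
  apply: (borel_forall hB) => j; apply: (borel_imply hB); first exact: borel_const.
  exact: bs_V S _.
apply: (borel_and hB) => //; apply: (borel_forall hB) => l.
apply: (borel_imply hB); first exact: bs_V S _.
apply: (borel_not hB); apply: borel_nbr; apply: (borel_and hB) => //.
by apply: (borel_not hB); exact: bs_V S _.
Qed.

Lemma indep_piece_indep s a b z : a \in L -> b \in L ->
  indep_piece s (act a z) -> indep_piece s (act b z) -> act a z = act b z.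
Proof.
move=> aL bL [_ h] [hb _]; apply: (bs_sep S) => l Vl; apply: contrapT => nV.
by apply: (h l Vl); exists a, b; do 2!split=> //; exists z.
Qed.

Lemma indep_piece_cover p : exists s, indep_piece s p.
Proof.
have [n hn] := nbr_enumerated; have [e he] := hn p.
have /choice[jj hjj] : forall i, exists j, e i <> p -> V j p /\ ~ V j (e i).
  move=> i; have [ep|ne] := pselect (e i = p); first by exists 0%N.
  by have [j hj] := separates_pointsP (bs_sep S) (fun h : p = e i => ne (esym h)); exists j.
exists [seq j <- map jj (iota 0 n) | `[< V j p >]]; split.
  by move=> j; rewrite mem_filter => /andP[/asboolP].
move=> l Vl [a [b [aL [bL [z [zp [hs nV]]]]]]].
have [|i [iN ei]] := he (act b z); first by exists a, b; do 2!split=> //; exists z.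
have [|h1 h2] := hjj i; first by move=> ep; apply: nV; rewrite -ei ep.
apply: h2; rewrite ei; apply: hs; rewrite mem_filter; apply/andP; split.
  exact/asboolP.
by apply: map_f; rewrite mem_iota add0n.
Qed.

Definition piece (n : nat) : set X :=
  if unpickle n is Some s then indep_piece s else set0.

(** The pieces are coloured one after the other.  A point coloured at stage [n] gets the
    least colour that does not occur yet among its neighbours; points treated at
    the same stage do not compete, as they form an independent set. *)
Fixpoint colored (n c : nat) : set X :=
  if n is n'.+1 then
    [set p | colored n' c p \/
      [/\ piece n' p, forall c', ~ colored n' c' p, ~ nbr (colored n' c) p &
          forall c', (c' < c)%N -> nbr (colored n' c') p]]
  else set0.

Definition newly_colored (n c : nat) (p : X) : Prop :=
  [/\ piece n p, forall c', ~ colored n c' p, ~ nbr (colored n c) p &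
      forall c', (c' < c)%N -> nbr (colored n c') p].

Lemma borel_colored n c : B (colored n c).
Proof.
elim: n c => [|n IH] c /=; first exact: borel0.
apply: (borel_or hB); first exact: IH.
apply: (@borel_ext _ _ (fun p => (piece n p /\ forall c', ~ colored n c' p) /\
  (~ nbr (colored n c) p /\ forall c', (c' < c)%N -> nbr (colored n c') p))).
  by move=> p; split=> [[[? ?] [? ?]]|[]].
apply: (borel_and hB).
  apply: (borel_and hB); last by apply: (borel_forall hB) => c'; apply: (borel_not hB); exact: IH.
  rewrite /piece; case: unpickle => [s|]; first exact: borel_indep_piece.
  exact: (borel0 hB).
apply: (borel_and hB); first by apply: (borel_not hB); apply: borel_nbr.
apply: (borel_forall hB) => c'; apply: (borel_imply hB); first exact: borel_const.
exact: borel_nbr.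
Qed.

Lemma coloredP n c p : colored n c p <-> exists m, (m < n)%N /\ newly_colored m c p.
Proof.
elim: n => [|n IH]; first by split=> [[]|[m []]].
split=> [[/IH[m [mn h]]|h]|[m []]].
- by exists m; split=> //; lia.
- by exists n.
- rewrite ltnS leq_eqVlt => /orP[/eqP ->|mn h]; first by right.
  by left; apply/IH; exists m.
Qed.

Lemma newly_colored_time n m c c' p :
  newly_colored n c p -> newly_colored m c' p -> n = m.
Proof.
move=> hn hm; have [nm|mn|//] := ltngtP n m.
- by have [_ h _ _] := hm; case: (h c); apply/coloredP; exists n.
- by have [_ h _ _] := hn; case: (h c'); apply/coloredP; exists m.
Qed.

Lemma newly_colored_unique n m c c' p :
  newly_colored n c p -> newly_colored m c' p -> c = c'.
Proof.
move=> hn hm; have E := newly_colored_time hn hm; rewrite -{m}E in hm.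
have [_ _ n1 n2] := hn; have [_ _ n3 n4] := hm.
by have [/n4|/n2|] := ltngtP c c'.
Qed.

(** Colours already used in the neighbourhood of [p] are carried by distinct neighbours,
    so a point never needs a colour larger than the degree of the graph. *)
Lemma nbr_colors_bounded n d c p : (forall p, enumerated d (fun q => nbr [set q] p)) ->
  (forall c', (c' < c)%N -> nbr (colored n c') p) -> (c <= d)%N.
Proof.
move=> hd h.
have /choice[g hg] : forall c', exists q, (c' < c)%N -> colored n c' q /\ nbr [set q] p.
  move=> c'; have [/h[a [b [aL [bL [z [zp hz]]]]]]|] := ltnP c' c; last by exists p.
  by exists (act b z) => _; split=> //; exists a, b; do 2!split=> //; exists z.
apply: (enumerated_inj (hd p) (g := g)) => [i /hg[]//|i j /hg[gi _] /hg[gj _] gij].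
move: gi gj; rewrite gij => /coloredP[m [_ hm]] /coloredP[m' [_ hm']].
exact: newly_colored_unique hm hm'.
Qed.

Theorem finite_borel_coloring : exists (q : nat) (chi : X -> nat),
  [/\ forall x, (chi x < q)%N, forall i, B [set x | chi x = i] &
      forall z a b, a \in L -> b \in L ->
        chi (act a z) = chi (act b z) -> act a z = act b z].
Proof.
have [d hd] := nbr_enumerated; exists d.+1.
have /choice[chi hchi] : forall p, exists c, exists n, newly_colored n c p.
  move=> p; have [s hs] := indep_piece_cover p; pose n := pickle s.
  have pn : piece n p by rewrite /piece pickleK.
  have [[c hc]|nc] := pselect (exists c, colored n c p).
    by exists c; move/coloredP: hc => [m [_ h]]; exists m.
  have exc : exists c, `[< ~ nbr (colored n c) p >].
    apply: contrapT => /forallNP hall.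
    suff : (d.+1 <= d)%N by rewrite ltnn.
    apply: (@nbr_colors_bounded n d d.+1 p hd) => c _; apply: contrapT => hc.
    by case: (hall c); apply/asboolP.
  have [c /asboolP hc cmin] := ex_minnP exc.
  exists c, n; split=> // [c' h|c' cc']; first by apply: nc; exists c'.
  by apply: contrapT => /asboolP /cmin; rewrite leqNgt cc'.
exists chi; split.
- move=> x; have [n [_ _ _ h]] := hchi x; rewrite ltnS.
  exact: nbr_colors_bounded hd h.
- move=> i; apply: (@borel_ext _ _ (fun x => exists n, colored n i x)).
    move=> x; split=> [[n /coloredP[m [_ hm]]]|<-].
      by have [m' hm'] := hchi x; exact: newly_colored_unique hm' hm.
    by have [m hm] := hchi x; exists m.+1; apply/coloredP; exists m.
  by apply: (borel_exists hB) => n; exact: borel_colored.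
- move=> z a b aL bL E; have [n hn] := hchi (act a z).
  have [m hm] := hchi (act b z); rewrite -E in hm.
  have [nm|mn|nm] := ltngtP n m.
  + have [_ _ h _] := hm; case: h; exists b, a; do 2!split=> //; exists z; split=> //.
    by apply/coloredP; exists n.
  + have [_ _ h _] := hn; case: h; exists a, b; do 2!split=> //; exists z; split=> //.
    by apply/coloredP; exists m.
  + have [+ _ _ _] := hn; have [+ _ _ _] := hm; rewrite -nm /piece; case: unpickle => // s.
    by move=> ha hb; exact: (indep_piece_indep aL bL hb ha).
Qed.

End Coloring.

(** * Nets visible in the forward direction *)

Section Vectors.
Variable M : countNmodType.

Definition gen (i : nat) : M := odflt 0%R (unpickle i).

Definition lincomb (k : nat) (u : nat -> nat) : M := (\sum_(i < k) gen i *+ u i)%R.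

Lemma lincombD k u v : (lincomb k u + lincomb k v = lincomb k (fun i => u i + v i)%N)%R.
Proof. by rewrite /lincomb -big_split /=; apply: eq_bigr => i _; rewrite mulrnDr. Qed.

Lemma lincomb_ext k u v : (forall i, (i < k)%N -> u i = v i) -> lincomb k u = lincomb k v.
Proof. by move=> h; apply: eq_bigr => i _; rewrite h. Qed.

Lemma lincomb_muln k r n : (lincomb k (fun=> r) *+ n = lincomb k (fun=> r * n)%N)%R.
Proof. by rewrite /lincomb -sumrMnl; apply: eq_bigr => i _; rewrite mulrnA. Qed.

Definition in_cube (k r : nat) (m : M) : Prop :=
  exists u, (forall i, (i < k)%N -> (u i <= r)%N) /\ m = lincomb k u.

Lemma in_cube0 k r : in_cube k r 0%R.
Proof.
exists (fun=> 0%N); split=> //.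
by rewrite /lincomb big1 // => i _; rewrite mulr0n.
Qed.

Lemma in_cubeD k r r' m m' :
  in_cube k r m -> in_cube k r' m' -> in_cube k (r + r') (m + m')%R.
Proof.
move=> [u [hu ->]] [v [hv ->]]; exists (fun i => u i + v i)%N; rewrite lincombD.
by split=> // i ik; rewrite leq_add ?hu ?hv.
Qed.

Lemma in_cubeW k k' r r' m : (k <= k')%N -> (r <= r')%N ->
  in_cube k r m -> in_cube k' r' m.
Proof.
move=> kk rr [u [hu ->]]; exists (fun i => if (i < k)%N then u i else 0%N); split.
  by move=> i _; case: ifP => // /hu h; exact: leq_trans rr.
rewrite /lincomb (big_ord_widen k' (fun i => gen i *+ u i)%R kk) big_mkcond /=.
by apply: eq_bigr => i _; case: ifP.
Qed.

Lemma in_cube_gen m : exists k r, in_cube k r m.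
Proof.
pose i := pickle m; exists i.+1, 1%N, (fun j => (j == i) : nat); split.
  by move=> j _; case: (j == i).
rewrite /lincomb big_ord_recr /= eqxx big1 ?add0r; last first.
  by move=> j _; rewrite ltn_eqF ?mulr0n.
by rewrite /gen pickleK.
Qed.

Lemma in_cube_list k r : exists L : seq M, forall m, in_cube k r m -> m \in L.
Proof.
elim: k => [|k [L hL]].
  by exists [:: 0%R] => m [u [_ ->]]; rewrite /lincomb big_ord0 inE.
exists [seq (m + gen k *+ j)%R | m <- L, j <- iota 0 r.+1] => m [u [hu ->]].
rewrite /lincomb big_ord_recr; apply/allpairsP; exists (lincomb k u, u k); split => //.
  by apply: hL; exists u; split=> // i ik; apply: hu; exact: ltnW.
by rewrite mem_iota add0n ltnS /= hu.
Qed.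

End Vectors.

Section Joined.
Variables (M : countNmodType) (X : Type) (act : M -> X -> X).
Hypothesis hact : monoid_action act.

(** The word metric of the first [k] generators, except that only the chains
    consisting of one move forward and one move backward are considered.
    Commutativity makes this relation additive ([joined_trans]). *)
Definition joined (k r : nat) (x y : X) : Prop :=
  exists a b, [/\ in_cube k r a, in_cube k r b & act a x = act b y].

Lemma joined_sym k r x y : joined k r x y -> joined k r y x.
Proof. by move=> [a [b [ha hb e]]]; exists b, a. Qed.

Lemma joined_refl k r x : joined k r x x.
Proof. by exists 0%R, 0%R; split=> //; exact: in_cube0. Qed.

Lemma joined_trans k r r' x y z :
  joined k r x y -> joined k r' y z -> joined k (r + r') x z.
Proof.
move=> [a [b [ha hb e]]] [a' [b' [ha' hb' e']]].
exists (a + a')%R, (b + b')%R; split; [exact: in_cubeD|exact: in_cubeD|].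
by rewrite addrC !hact.2 e -hact.2 addrC hact.2 e'.
Qed.

Lemma joinedW k k' r r' x y : (k <= k')%N -> (r <= r')%N ->
  joined k r x y -> joined k' r' x y.
Proof. by move=> kk rr [a [b [ha hb e]]]; exists a, b; split=> //; exact: in_cubeW kk rr _. Qed.

Lemma joined_act k r a x : in_cube k r a -> joined k r x (act a x).
Proof.
by move=> ha; exists a, 0%R; split=> //; [exact: in_cube0|rewrite hact.1].
Qed.

End Joined.

(** A covering by balls at one scale: [sc_within d x s] says that [s] is a centre at
    distance at most [d] from [x], [sc_moves] contains the moves from points to
    nearby centres, [sc_reach] bounds the coefficients of these moves, and
    [sc_color] tells apart the centres near a given point. *)
Record scale (M : Type) (X : Type) : Type := Scale {
  sc_reach : nat;
  sc_moves : seq M;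
  sc_within : nat -> X -> X -> Prop;
  sc_color : X -> nat }.

(** The bound in [gs_count] depends on [k] only, whereas [sc_reach] may be much larger
    than [r]: the distance used in [sc_within] is measured from a grid position
    far ahead of [x].  [gs_lip] is the triangle inequality. *)
Record good_scale (M : countNmodType) (X : Type) (B : set (set X))
    (act : M -> X -> X) (k r : nat) (sc : scale M X) : Prop := GoodScale {
  gs_reach : (r <= sc_reach sc)%N;
  gs_cover : forall x, exists s, sc_within sc r x s;
  gs_mono : forall d d' x s, (d <= d')%N -> sc_within sc d x s -> sc_within sc d' x s;
  gs_lip : forall e d x y s, joined act k e x y -> (e <= r)%N -> (d <= 2 * r)%N ->
    sc_within sc d x s -> sc_within sc (d + e) y s;
  gs_moves : forall x s, sc_within sc (3 * r) x s ->
    exists a, [/\ a \in sc_moves sc, in_cube k (sc_reach sc) a & s = act a x];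
  gs_count : forall x, enumerated (8 ^ k) (sc_within sc (3 * r) x);
  gs_color : forall x s s', sc_within sc (3 * r) x s -> sc_within sc (3 * r) x s' ->
    sc_color sc s = sc_color sc s' -> s = s';
  gs_borel_color : forall i, B [set s | sc_color sc s = i];
  gs_borel : forall d a, B [set x | sc_within sc d x (act a x)] }.

Section Net.
Variables (M : countNmodType) (X : Type) (B : set (set X)) (act : M -> X -> X).
Variable V : nat -> set X.
Hypothesis S : borel_system B act V.
Let hB := bs_sigma S.
Let hact := bs_act S.
Variables (k r q : nat) (chi : X -> nat).
Hypotheses (chi_lt : forall x, (chi x < q)%N) (chi_borel : forall i, B [set x | chi x = i])
  (chi_proper : forall z a b, in_cube k r a -> in_cube k r b ->
    chi (act a z) = chi (act b z) -> act a z = act b z).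

Let step : M := lincomb M k (fun=> r).

(** Greedy construction of a maximal [r]-separated set of grid positions, colour by
    colour.  [marked i x] is the decision, after the first [i] colours, about the
    position [x + i step].  Deciding about a position in round [i.+1] requires
    the outcome of round [i] for all positions within [r] of it; as seen from
    [x] these are the positions [x + v + i step] with [v] in the cube of side
    [2 r], so only the forward orbit of [x] is inspected. *)
Fixpoint marked (i : nat) (x : X) : Prop :=
  if i is i'.+1 then
    marked i' (act step x) \/
    (chi (act (step *+ i)%R x) = i' /\
     forall v, in_cube k (2 * r) v -> ~ marked i' (act v x))
  else False.

Lemma borel_marked i : B [set x | marked i x].
Proof.
elim: i => [|i IH] /=; first exact: borel_const.
have bm v : B [set x | marked i (act v x)] by exact: (bs_borel S v IH).
apply: (borel_or hB); first exact: bm.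
apply: (borel_and hB); first exact: (bs_borel S _ (chi_borel i)).
apply: (borel_forall hB) => v; apply: (borel_imply hB); first exact: borel_const.
by apply: (borel_not hB).
Qed.

(** Two marked positions at distance at most [r] were marked in the same round, so the
    points there have the same colour, and then they are the same point because
    the colouring is proper.  The vectors [u] and [u'] may nevertheless be
    different, since the action need not be free. *)
Lemma marked_sep i x u u' :
  (forall j, (j < k)%N -> (u j <= u' j + r)%N /\ (u' j <= u j + r)%N) ->
  marked i (act (lincomb M k u) x) -> marked i (act (lincomb M k u') x) ->
  act (lincomb M k u + step *+ i)%R x = act (lincomb M k u' + step *+ i)%R x.
Proof.
have clash u1 u2 i' : (forall j, (j < k)%N -> (u1 j <= u2 j + r)%N /\ (u2 j <= u1 j + r)%N) ->
    marked i' (act step (act (lincomb M k u1) x)) ->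
    ~ (forall v, in_cube k (2 * r) v -> ~ marked i' (act v (act (lincomb M k u2) x))).
  move=> h m1 /(_ (lincomb M k (fun j => u1 j + r - u2 j)%N)); apply.
    exists (fun j => u1 j + r - u2 j)%N; split=> // j /h; lia.
  move: m1; rewrite -!hact.2 /step !lincombD.
  suff -> : lincomb M k (fun j => r + u1 j)%N = lincomb M k (fun j => u1 j + r - u2 j + u2 j)%N by [].
  by apply: lincomb_ext => j /h; lia.
elim: i u u' => [|i IH] u u' uu //=.
move=> [m1|[c1 n1]] [m2|[c2 n2]].
- rewrite -!hact.2 !lincombD in m1 m2.
  have := IH _ _ _ m1 m2; rewrite -!lincombD -/step mulrS !addrA.
  by rewrite ![(_ + step)%R]addrC; apply => j /uu; lia.
- by case: (clash u u' i).
- by case: (clash u' u i) => // j /uu [].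
- pose w j := minn (u j) (u' j).
  have E v : (forall j, (j < k)%N -> (w j <= v j)%N) ->
      (lincomb M k v + step *+ i.+1 = lincomb M k (fun j => v j - w j)%N + (lincomb M k w + step *+ i.+1))%R.
    move=> wv; rewrite addrA lincombD; congr (_ + _)%R.
    by apply: lincomb_ext => j /wv; lia.
  rewrite (E u) ?(E u'); try by move=> j _; rewrite /w; lia.
  rewrite !(hact.2 (lincomb M k (fun _ => _ - _)%N)); apply: chi_proper.
  + by exists (fun j => u j - w j)%N; split=> // j /uu; rewrite /w; lia.
  + by exists (fun j => u' j - w j)%N; split=> // j /uu; rewrite /w; lia.
  + rewrite -!hact.2 -!E; try by move=> j _; rewrite /w; lia.
    by rewrite ![(lincomb M k _ + step *+ _)%R]addrC !hact.2 c1 c2.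
Qed.

Lemma marked_later i j x : marked i (act (step *+ j)%R x) -> marked (i + j) x.
Proof.
elim: j x => [|j IH] x; first by rewrite mulr0n hact.1 addn0.
rewrite mulrSr hact.2 => /IH h; rewrite addnS /=; left; exact: h.
Qed.

(** Maximality: in the round of its own colour, the position [x + step + q step] is either
    marked or blocked by a marked position within [r]. *)
Lemma marked_cover x : exists v, in_cube k (2 * r) v /\ marked q (act v x).
Proof.
pose i := chi (act (step *+ q.+1)%R x); have iq : (i < q)%N by exact: chi_lt.
pose x' := act (step *+ (q - i))%R x.
have [nm|/existsNP[v /not_implyP[hv /contrapT mv]]] :=
    pselect (forall v, in_cube k (2 * r) v -> ~ marked i (act v x')).
  exists step; split; first by exists (fun=> r); split=> // j _; lia.
  have -> : q = (i.+1 + (q - i.+1))%N by lia.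
  apply: marked_later; rewrite -hact.2 -mulrSr -subSn // subSS.
  by right; split=> //; rewrite -hact.2 -mulrnDr addSn subnKC // ltnW.
exists v; split=> //; have -> : q = (i + (q - i))%N by lia.
by apply: marked_later; rewrite -hact.2 addrC hact.2.
Qed.

(** The position [m] of a centre is compared with the point of coordinates [4 r], so
    that as long as [d] is at most [3 r] there is room on all sides for
    subtracting a vector with coefficients at most [r]; this is what makes the
    triangle inequality [net_lip] true. *)
Definition net_within (d : nat) (x s : X) : Prop :=
  exists m, (exists u, (forall j, (j < k)%N -> (4 * r <= u j + d)%N /\ (u j <= 4 * r + d)%N) /\
      m = lincomb M k u) /\
    marked q (act m x) /\ act (step *+ q + m)%R x = s.

Lemma net_cover x : exists s, net_within r x s.
Proof.
have [v [[u [hu ->]] mv]] := marked_cover (act (lincomb M k (fun=> 3 * r)%N) x).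
exists (act (step *+ q + (lincomb M k (fun j => u j + 3 * r)%N))%R x).
exists (lincomb M k (fun j => u j + 3 * r)%N); split; last first.
  by split=> //; rewrite -lincombD hact.2.
exists (fun j => u j + 3 * r)%N; split=> // j /hu; lia.
Qed.

Lemma net_mono d d' x s : (d <= d')%N -> net_within d x s -> net_within d' x s.
Proof.
move=> dd [m [[u [hu um]] h]]; exists m; split=> //; exists u; split=> // j /hu; lia.
Qed.

Lemma net_lip e d x y s : joined act k e x y -> (e <= r)%N -> (d <= 2 * r)%N ->
  net_within d x s -> net_within (d + e) y s.
Proof.
move=> [_ [_ [[a [ha ->]] [b [hb ->]] xy]]] er dr [_ [[u [hu ->]] [mu us]]].
have E : lincomb M k u = (lincomb M k (fun j => u j - a j)%N + lincomb M k a)%R.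
  by rewrite lincombD; apply: lincomb_ext => j jk; have := ha _ jk; have := hu _ jk; lia.
have Eb : lincomb M k (fun j => u j - a j + b j)%N =
    (lincomb M k (fun j => u j - a j)%N + lincomb M k b)%R by rewrite lincombD.
exists (lincomb M k (fun j => u j - a j + b j)%N); split; last first.
  rewrite -us Eb E !addrA !hact.2 xy; split=> //.
  by move: mu; rewrite E hact.2 xy -hact.2.
exists (fun j => u j - a j + b j)%N; split=> // j jk.
by have := ha _ jk; have := hb _ jk; have := hu _ jk; lia.
Qed.

Lemma net_moves x s : net_within (3 * r) x s ->
  exists a, in_cube k ((q + 7) * r) a /\ s = act a x.
Proof.
move=> [_ [[u [hu ->]] [_ <-]]]; eexists; split; last by reflexivity.
rewrite lincomb_muln lincombD; exists (fun j => r * q + u j)%N; split=> // j /hu; lia.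
Qed.

(** Positions in the same cube of side [r] carry the same centre by [marked_sep], and
    the positions with coordinates in [[r, 7 r]] lie in at most [8 ^ k] cubes of
    the grid of mesh [r]. *)
Lemma net_count x : (0 < r)%N -> enumerated (8 ^ k) (net_within (3 * r) x).
Proof.
move=> r0.
pose C := {ffun 'I_k -> 'I_8}.
have /choice[e he] : forall c : C, exists s, forall u : nat -> nat,
    (forall j : 'I_k, u j %/ r = c j) -> marked q (act (lincomb M k u) x) ->
    act (step *+ q + lincomb M k u)%R x = s.
  move=> c.
  have [[u [cu mu]]|nu] := pselect (exists u : nat -> nat, (forall j : 'I_k, u j %/ r = c j) /\
      marked q (act (lincomb M k u) x)); last by exists x => u cu mu; case: nu; exists u.
  exists (act (step *+ q + lincomb M k u)%R x) => u' cu' mu'.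
  rewrite ![(step *+ q + _)%R]addrC; apply: marked_sep => // j jk.
  have := cu (Ordinal jk); have := cu' (Ordinal jk) => /= E1 E2.
  have := divn_eq (u j) r; have := divn_eq (u' j) r; rewrite E1 E2.
  have := ltn_pmod (u j) r0; have := ltn_pmod (u' j) r0; lia.
have cC : #|{: C}| = (8 ^ k)%N by rewrite card_ffun !card_ord.
exists (fun n => if insub n is Some i then e (enum_val (cast_ord (esym cC) i)) else x).
move=> s [_ [[u [hu ->]] [mu us]]].
have hd j : (j < k)%N -> (u j %/ r < 8)%N.
  by move=> /hu; rewrite ltn_divLR //; lia.
pose c : C := [ffun j : 'I_k => Ordinal (hd j (ltn_ord j))].
exists (cast_ord cC (enum_rank c)); split; first exact: ltn_ord.
rewrite valK cast_ordK enum_rankK -us.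
by apply/esym/he => // j; rewrite ffunE.
Qed.

Lemma borel_net d a : B [set x | net_within d x (act a x)].
Proof.
apply: (borel_exists hB) => m; apply: (borel_and hB); first exact: borel_const.
apply: (borel_and hB); first exact: (bs_borel S _ (borel_marked q)).
by apply: (borel_map_eq hB (bs_V S) (bs_sep S)); exact: (bs_borel S).
Qed.

End Net.

Theorem good_scale_exists (M : countNmodType) (X : Type) (B : set (set X))
    (act : M -> X -> X) (V : nat -> set X) (k r : nat) :
  borel_system B act V -> (0 < r)%N -> exists sc : scale M X, good_scale B act k r sc.
Proof.
move=> S r0.
have [L hL] := in_cube_list M k r.
have [q [chi [chi_lt chi_b chi_p]]] := finite_borel_coloring S L.
have chi_p' z a b : in_cube k r a -> in_cube k r b ->
    chi (act a z) = chi (act b z) -> act a z = act b z.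
  by move=> /hL aL /hL bL; exact: chi_p.
have [L' hL'] := in_cube_list M k ((q + 7) * r).
have [q' [chi' [_ chi'_b chi'_p]]] := finite_borel_coloring S L'.
exists (Scale ((q + 7) * r) L' (net_within act k r q chi) chi'); split=> /=.
- by rewrite leq_pmull // addnS.
- exact: (net_cover S).
- exact: net_mono.
- exact: (net_lip S).
- by move=> x s h; have [a [ha ->]] := net_moves h; exists a; split=> //; exact: hL'.
- by move=> x; exact: (net_count S).
- move=> x s s' h h'; have [a [ha ->]] := net_moves h; have [b [hb ->]] := net_moves h'.
  by apply: chi'_p; exact: hL'.
- exact: chi'_b.
- exact: (borel_net S).
Qed.

(** * The hierarchy of scales *)

Section Hierarchy.
Variables (M : countNmodType) (X : Type) (B : set (set X)) (act : M -> X -> X).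
Variable V : nat -> set X.
Hypothesis S : borel_system B act V.
Let hB := bs_sigma S.
Let hact := bs_act S.
Variables (sc : nat -> scale M X) (r delta drift : nat -> nat).
(* [levels k] bounds the number of levels that matter around a centre at scale [k],
   and [gap k] is the difference of consecutive radii: two spheres whose radii
   differ by it cannot both be within [delta k] of the same point. *)
Let levels (k : nat) : nat := (8 ^ k.+1).+1.
Let gap (k : nat) : nat := (2 * delta k).+1.
Hypotheses (sc_good : forall k, good_scale B act k (r k) (sc k))
  (rE : forall k, r k = (levels k).+1 * gap k)
  (reach_delta : forall k, 3 * sc_reach (sc k) <= delta k.+1)
  (drift_delta : forall k, drift k + k <= delta k)
  (driftS : forall k, drift k.+1 = drift k + sc_reach (sc k)).

(** The radius of the ball around [s], when [j] gives the rank of the current level at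
    each centre.  Truncating at [levels k] does not change the ranks that matter,
    by [cut_count], and makes every radius at most [2 * r k] from the start. *)
Definition threshold (k : nat) (j : X -> nat) (s : X) : nat :=
  r k + gap k * minn (j s) (levels k).

Lemma threshold_le k j s : threshold k j s <= 2 * r k.
Proof.
rewrite /threshold mul2n -addnn leq_add2l rE mulnC leq_mul2r.
by rewrite (leq_trans (geq_minr _ _)) ?orbT.
Qed.

Lemma delta_le_r k : delta k <= r k.
Proof. by rewrite rE /gap; nia. Qed.

(** Among the centres whose ball contains [x], the one of least colour: this depends only
    on the set of these centres, not on [x] itself. *)
Definition chosen (k : nat) (j : X -> nat) (x s : X) : Prop :=
  sc_within (sc k) (threshold k j s) x s /\
  forall s', sc_within (sc k) (threshold k j s') x s' ->
    sc_color (sc k) s <= sc_color (sc k) s'.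

Lemma within_threshold k j x s : sc_within (sc k) (threshold k j s) x s ->
  sc_within (sc k) (3 * r k) x s.
Proof. by apply: (gs_mono (sc_good k)); have := threshold_le k j s; lia. Qed.

Lemma chosen_exists k j x : exists s, chosen k j x s.
Proof.
pose Q c := `[< exists s, sc_within (sc k) (threshold k j s) x s /\ sc_color (sc k) s = c >].
have exQ : exists c, Q c.
  have [s hs] := gs_cover (sc_good k) x.
  exists (sc_color (sc k) s); apply/asboolP; exists s; split=> //.
  by apply: (gs_mono (sc_good k)) hs; rewrite /threshold leq_addr.
have [c /asboolP[s [hs <-]] cmin] := ex_minnP exQ.
by exists s; split=> // s' hs'; apply: cmin; apply/asboolP; exists s'.
Qed.

Lemma chosen_unique k j x s s' : chosen k j x s -> chosen k j x s' -> s = s'.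
Proof.
move=> [h1 h2] [h3 h4]; apply: (gs_color (sc_good k) (x := x)).
- exact: within_threshold h1.
- exact: within_threshold h3.
- by apply/eqP; rewrite eqn_leq h2 // h4.
Qed.

Definition center (k : nat) (j : X -> nat) (x : X) : X :=
  projT1 (cid (chosen_exists k j x)).

Lemma centerP k j x : chosen k j x (center k j x).
Proof. exact: projT2 (cid _). Qed.

Lemma center_moves k j x : exists a,
  [/\ a \in sc_moves (sc k), in_cube k (sc_reach (sc k)) a & center k j x = act a x].
Proof.
apply: (gs_moves (sc_good k)); have [h _] := centerP k j x.
exact: within_threshold h.
Qed.

Definition separated_nearby (k : nat) (h : X -> X) (s : X) : Prop :=
  exists y, joined act k (delta k) s y /\ h y <> h s.

(** At scale [k] the composition for level [n] begins with a move to a centre; the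
    radii used for it take into account which of the previous levels [n'] still
    separate the centre from its neighbours at scale [k.+1].  The recursion is on
    the number of remaining scales, hence the fuel. *)
Fixpoint collapse_rec (fuel n k : nat) : X -> X :=
  if fuel is f.+1 then
    if n < k then id else
    fun x => collapse_rec f n k.+1 (center k
      (fun s => \sum_(k.+1 <= n' < n) `[< separated_nearby k.+1 (collapse_rec f n' k.+1) s >]) x)
  else id.

Lemma collapse_rec_fuel f f' n k : n.+1 - k <= f -> n.+1 - k <= f' ->
  collapse_rec f n k = collapse_rec f' n k.
Proof.
elim: f f' n k => [|f IH] [|f'] n k hf hf' //=; case: ltnP => // kn; try lia.
apply/funext => x.
rewrite (IH f'); try lia; congr (collapse_rec _ _ _ (center _ _ _)).
apply/funext => s; apply: eq_big_nat => n' /andP[kn' nn'].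
by rewrite (IH f') //; lia.
Qed.

Definition collapse (n k : nat) : X -> X := collapse_rec (n.+1 - k) n k.

Definition cut (k n : nat) (s : X) : Prop := separated_nearby k (collapse n k) s.

Definition rank (k n : nat) (s : X) : nat := \sum_(k.+1 <= n' < n) `[< cut k.+1 n' s >].

Lemma collapse_id n k : n < k -> collapse n k = id.
Proof. by move=> nk; rewrite /collapse (_ : n.+1 - k = 0)%N //; lia. Qed.

Lemma collapseE n k x : k <= n ->
  collapse n k x = collapse n k.+1 (center k (rank k n) x).
Proof.
move=> kn; rewrite /collapse subSn //= ltnNge kn /=.
rewrite (@collapse_rec_fuel _ (n.+1 - k.+1)); try lia.
congr (collapse_rec _ _ _ (center _ _ _)).
apply/funext => s; apply: eq_big_nat => n' /andP[kn' nn'].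
by rewrite /cut /collapse (@collapse_rec_fuel _ (n'.+1 - k.+1)) //; lia.
Qed.

(** If [x] and a neighbour [y] are not sent to the same centre, some centre [s] has
    exactly one of them in its ball, so [x] is within [delta k] of its sphere.  Moreover
    [s] is joined at the next scale to the centres chosen for [x] and [y], which
    the later stages keep apart; so these stages cut next to [s]. *)
Lemma cut_witness k n x : k <= n -> cut k n x -> exists s,
  let d := threshold k (rank k n) s in
  [/\ sc_within (sc k) (3 * r k) x s, sc_within (sc k) (d + delta k) x s,
      ~ sc_within (sc k) (d - delta k) x s & cut k.+1 n s].
Proof.
move=> kn [y [xy]]; rewrite (collapseE x kn) (collapseE y kn) => Gxy.
set j := rank k n in Gxy *.
have [[cx1 cx2] [cy1 cy2]] := (centerP k j x, centerP k j y).
have lip p p' s d : joined act k (delta k) p p' -> d <= 2 * r k ->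
    sc_within (sc k) d p s -> sc_within (sc k) (d + delta k) p' s.
  by move=> pp dr; apply: (gs_lip (sc_good k) pp (delta_le_r k) dr).
have yx := joined_sym xy.
have [s hs] : exists s, ~ (sc_within (sc k) (threshold k j s) x s <->
    sc_within (sc k) (threshold k j s) y s).
  apply: contrapT => /forallNP h; apply: Gxy; congr (collapse _ _ _).
  have h' s : sc_within (sc k) (threshold k j s) x s <->
    sc_within (sc k) (threshold k j s) y s by apply: contrapT; exact: h.
  apply: (@chosen_unique k j x); split=> //; first exact/h'.
  by move=> s' /h'; exact: cy2.
have dd := delta_le_r k; have tl := threshold_le k j s.
have [w1 w2] : sc_within (sc k) (threshold k j s + delta k) x s /\
    ~ sc_within (sc k) (threshold k j s - delta k) x s.
  have [wx|nwx] := pselect (sc_within (sc k) (threshold k j s) x s).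
    split; first by apply: (gs_mono (sc_good k)) wx; rewrite leq_addr.
    move=> w; apply: hs; split=> // _.
    have := lip _ _ _ _ xy _ w; rewrite subnK; first by apply; lia.
    by rewrite (leq_trans dd) // leq_addr.
  split; last by move=> w; apply: nwx; apply: (gs_mono (sc_good k)) w; rewrite leq_subr.
  have wy : sc_within (sc k) (threshold k j s) y s.
    by apply: contrapT => nwy; apply: hs; split.
  exact: (lip _ _ _ _ yx _ wy).
have w3 : sc_within (sc k) (3 * r k) x s.
  by apply: (gs_mono (sc_good k)) w1; lia.
exists s; split => //.
have [a [_ ha sa]] := gs_moves (sc_good k) w3.
have [b [_ hb cb]] := center_moves k j x.
have [c [_ hc cc]] := center_moves k j y.
have xs := joined_act hact x ha; rewrite -sa in xs.
have xcx := joined_act hact x hb; rewrite -cb in xcx.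
have ycy := joined_act hact y hc; rewrite -cc in ycy.
have rd := reach_delta k; have rr := gs_reach (sc_good k).
have scx : joined act k.+1 (delta k.+1) s (center k j x).
  apply: joinedW (joined_trans hact (joined_sym xs) xcx); lia.
have scy : joined act k.+1 (delta k.+1) s (center k j y).
  apply: joinedW (joined_trans hact (joined_trans hact (joined_sym xs) xy) ycy); lia.
have [E|ne] := pselect (collapse n k.+1 (center k j x) = collapse n k.+1 s).
  by exists (center k j y); split=> // E'; apply: Gxy; rewrite E E'.
by exists (center k j x).
Qed.

Lemma sum_asbool_count (P : nat -> Prop) m n :
  \sum_(m <= i < n) `[< P i >] = size [seq i <- index_iota m n | `[< P i >]].
Proof.
by rewrite size_filter -sum1_count [RHS]big_mkcond; apply: eq_bigr => i _; case: asboolP.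
Qed.

(** Distinct levels [n' > k] that cut next to [x] are witnessed by distinct centres.
    Indeed if [i < j] had the same witness [s], the level [i] would be counted in
    the rank of [j] at [s], so that the radii of [s] for [i] and [j] would differ
    by at least [gap k], and the two spheres could not both pass near [x]. *)
Lemma cut_count k n x : \sum_(k <= n' < n) `[< cut k n' x >] <= (8 ^ k).+1.
Proof.
have [d] : exists d, n - k <= d by exists (n - k).
elim: d k x => [|d IH] k x hd; first by rewrite big_geq //; lia.
have [nk|kn] := leqP n k; first by rewrite big_geq.
rewrite big_ltn // addnC -[leqRHS]addn1; apply: leq_add; last by case: asboolP.
rewrite sum_asbool_count; set l := [seq _ <- _ | _].
have lP i : i \in l -> [/\ k < i, i < n & cut k i x].
  by rewrite mem_filter mem_index_iota => /andP[/asboolP ? /andP[]].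
have rank_le i s : i < n -> rank k i s <= levels k.
  move=> ilt; apply: leq_trans (IH k.+1 s _); last by lia.
  have [ik|ki] := leqP i k.+1; first by rewrite /rank big_geq.
  by rewrite /rank [leqRHS](big_cat_nat (n := i)) /= ?leq_addr // ltnW.
have /choice[w hw] : forall i, exists s, i \in l ->
    let d := threshold k (rank k i) s in
    [/\ sc_within (sc k) (3 * r k) x s, sc_within (sc k) (d + delta k) x s,
      ~ sc_within (sc k) (d - delta k) x s & cut k.+1 i s].
  move=> i; have [/lP[ki _ ci]|] := boolP (i \in l); last by exists x.
  by have [s hs] := cut_witness (ltnW ki) ci; exists s.
have wlt i j : i \in l -> j \in l -> i < j -> w i <> w j.
  move=> il jl ij E; have [_ w1 _ ci] := hw _ il; have [_ _ w2 _] := hw _ jl.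
  have [[ki ni _] [kj nj _]] := (lP _ il, lP _ jl).
  apply: w2; rewrite -E; apply: (gs_mono (sc_good k)) w1.
  have : rank k i (w i) < rank k j (w i).
    rewrite /rank [X in _ < X](big_cat_nat (n := i)) //=; last exact: ltnW.
    by rewrite [X in _ + X]big_ltn // (asboolT ci) addnA addn1 ltnS leq_addr.
  have := rank_le i (w i) ni; have := rank_le j (w i) nj; rewrite /threshold /gap.
  move=> r1 r2 r12; rewrite (minn_idPl r1) (minn_idPl r2); nia.
apply: (enumerated_inj (gs_count (sc_good k) x) (g := fun i => w (nth 0 l i))).
  by move=> i il; have [] := hw _ (mem_nth 0 il).
move=> i j il jl E.
have ul : uniq l by rewrite filter_uniq // iota_uniq.
apply/eqP; rewrite -(nth_uniq 0 il jl ul); apply/eqP.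
have [ij|ji|//] := ltngtP (nth 0 l i) (nth 0 l j).
- by case: (wlt _ _ (mem_nth 0 il) (mem_nth 0 jl) ij).
- by case: (wlt _ _ (mem_nth 0 jl) (mem_nth 0 il) ji).
Qed.

Lemma cut_finite k x : exists N, forall n, N <= n -> ~ cut k n x.
Proof.
pose T m := \sum_(k <= n' < m) `[< cut k n' x >].
pose Q c := `[< exists m, k <= m /\ T m = c >].
have exQ : exists c, Q c by exists (T k); apply/asboolP; exists k.
have ubQ c : Q c -> c <= (8 ^ k).+1 by move=> /asboolP[m [_ <-]]; exact: cut_count.
have [c /asboolP[m [km <-]] cmax] := ex_maxnP exQ ubQ.
exists m => n mn cn; suff : T n.+1 <= T m.
  apply/negP; rewrite -ltnNge.
  rewrite /T big_nat_recr /=; last lia.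
  by rewrite (asboolT cn) addn1 ltnS [leqRHS](big_cat_nat (n := m)) //= leq_addr.
by apply: cmax; apply/asboolP; exists n.+1; split=> //; lia.
Qed.

(** The stages below [k] move a point by a distance that is small at scale [k]. *)
Lemma collapse_drift n k x : k <= n.+1 ->
  exists x', joined act k (drift k) x x' /\ collapse n 0 x = collapse n k x'.
Proof.
elim: k => [|k IH] kn; first by exists x; split=> //; exact: joined_refl.
have [|x' [xx' ->]] := IH; first lia.
rewrite collapseE //; exists (center k (rank k n) x'); split=> //.
have [a [_ ha ->]] := center_moves k (rank k n) x'.
rewrite driftS; apply: joinedW (joined_trans hact xx' (joined_act hact x' ha)) => //.
Qed.

Lemma collapse_near k e x y : joined act k e x y ->
  exists N, forall n, N <= n -> collapse n 0 x = collapse n 0 y.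
Proof.
move=> xy0; pose m := maxn k e.
have xy : joined act m m x y by apply: joinedW xy0; rewrite /m; lia.
have [N hN] := cut_finite m x; exists (maxn N m) => n nN; apply: contrapT => ne.
apply: (hN n); first lia.
have [|x' [xx' Ex]] := @collapse_drift n m x; first lia.
have [|y' [yy' Ey]] := @collapse_drift n m y; first lia.
rewrite Ex Ey in ne; have dd := drift_delta m.
have nx : joined act m (delta m) x x' by apply: joinedW xx'; lia.
have ny : joined act m (delta m) x y' by apply: joinedW (joined_trans hact xy yy'); lia.
have [E|nE] := pselect (collapse n m x' = collapse n m x); last by exists x'.
by exists y'; split=> // E'; apply: ne; rewrite E E'.
Qed.

Lemma borel_sum (P : nat -> X -> Prop) m n i : (forall k, B [set x | P k x]) ->
  B [set x | \sum_(m <= k < n) `[< P k x >] = i].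
Proof.
move=> bP; elim: n i => [|n IH] i.
  apply: (@borel_ext _ _ (fun=> 0 = i)); last exact: borel_const.
  by move=> x; rewrite big_geq.
have [mn|nm] := leqP m n; last first.
  apply: (@borel_ext _ _ (fun=> 0 = i)); last exact: borel_const.
  by move=> x; rewrite big_geq.
apply: (@borel_ext _ _ (fun x => exists a,
  \sum_(m <= k < n) `[< P k x >] = a /\ ((P n x /\ a.+1 = i) \/ (~ P n x /\ a = i)))).
  move=> x; rewrite big_nat_recr //=; split.
    by move=> [a [-> [[Pn <-]|[nP <-]]]]; [rewrite (asboolT Pn) addn1|rewrite (asboolF nP) addn0].
  move=> <-; eexists; split; first reflexivity.
  by case: asboolP => Pn; [left; rewrite addn1|right; rewrite addn0].
apply: (borel_exists hB) => a; apply: (borel_and hB); first exact: IH.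
apply: (borel_or hB); apply: (borel_and hB) => //; try exact: borel_const.
exact: (borel_not hB).
Qed.

(** The centre is one of the points [act a x], so quantifying over centres amounts to
    quantifying over the countable monoid. *)
Lemma borel_center k (j : X -> nat) :
  (forall i, B [set s | j s = i]) -> borel_map B (center k j).
Proof.
move=> bj A bA.
have bw a : B [set x | sc_within (sc k) (threshold k j (act a x)) x (act a x)].
  apply: (@borel_ext _ _ (fun x => exists i, j (act a x) = i /\
    sc_within (sc k) (r k + gap k * minn i (levels k)) x (act a x))).
    by move=> x; split=> [[i [<-]]|w] //; exists (j (act a x)).
  apply: (borel_exists hB) => i; apply: (borel_and hB).
    exact: (bs_borel S a (bj i)).
  exact: gs_borel (sc_good k) _ _.
apply: (@borel_ext _ _ (fun x => exists a,
  sc_within (sc k) (threshold k j (act a x)) x (act a x) /\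
  ((forall b, sc_within (sc k) (threshold k j (act b x)) x (act b x) ->
     sc_color (sc k) (act a x) <= sc_color (sc k) (act b x)) /\ A (act a x)))).
  move=> x; split=> [[a [w [h Aa]]]|Ac].
    suff <- : act a x = center k j x by [].
    apply: (@chosen_unique k j x _ _ _ (centerP k j x)); split=> // s ws.
    have [b [_ _ E]] := gs_moves (sc_good k) (within_threshold ws).
    by rewrite E in ws *; exact: h.
  have [w h] := centerP k j x; have [a [_ _ E]] := center_moves k j x.
  by exists a; rewrite -E; do !split=> //; move=> b; exact: h.
apply: (borel_exists hB) => a; apply: (borel_and hB); first exact: bw.
apply: (borel_and hB); last exact: (bs_borel S a bA).
apply: (borel_forall hB) => b; apply: (borel_imply hB); first exact: bw.
apply: (@borel_ext _ _ (fun x => forall i i', sc_color (sc k) (act a x) = i ->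
   sc_color (sc k) (act b x) = i' -> i <= i')).
  by move=> x; split=> [|h i i' <- <-] //; apply.
apply: (borel_forall hB) => i; apply: (borel_forall hB) => i'.
apply: (borel_imply hB); first exact: (bs_borel S _ (gs_borel_color (sc_good k) i)).
apply: (borel_imply hB); first exact: (bs_borel S _ (gs_borel_color (sc_good k) i')).
exact: borel_const.
Qed.

(** The quantifier over the points [y] joined to [s] runs backwards along the action; it
    is eliminated by taking the image of a Borel set. *)
Lemma borel_separated_nearby k (h : X -> X) : borel_map B h -> B [set s | separated_nearby k h s].
Proof.
move=> bh; apply: (@borel_ext _ _ (fun s => exists v a b, (in_cube k (delta k) a /\
   in_cube k (delta k) b) /\ (V v (h s) /\ exists y, act a s = act b y /\ ~ V v (h y)))).
  move=> s; split=> [[v [a [b [[ha hb] [Vs [y [ay nV]]]]]]]|[y [[a [b [ha hb ab]]] ne]]].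
    exists y; split; first by exists a, b.
    by move=> E; apply: nV; rewrite E.
  have [v [Vs nVy]] := separates_pointsP (bs_sep S) (fun E : h s = h y => ne (esym E)).
  by exists v, a, b; do !split=> //; exists y.
apply: (borel_exists hB) => v; apply: (borel_exists hB) => a; apply: (borel_exists hB) => b.
apply: (borel_and hB); first exact: borel_const.
apply: (borel_and hB); first exact: (bh _ (bs_V S v)).
apply: (@borel_ext _ _ (act a @^-1` (act b @` (h @^-1` (~` V v))))).
  by move=> s; split=> [[y nV E]|[y [E nV]]]; exists y.
apply: (bs_borel S); apply: (bs_image S); apply: bh.
exact: (borel_not hB (bs_V S v)).
Qed.

Lemma borel_collapse n k : borel_map B (collapse n k).
Proof.
have [d] : exists d, n.+1 - k <= d by exists (n.+1 - k).
elim: d n k => [|d IH] n k hd; first by rewrite collapse_id //; lia.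
have [kn|nk] := leqP k n; last by rewrite collapse_id.
have -> : collapse n k = collapse n k.+1 \o center k (rank k n).
  by apply/funext => x; rewrite collapseE.
have bc : borel_map B (center k (rank k n)).
  apply: borel_center => i; rewrite /rank.
  apply: (@borel_ext _ _ (fun s =>
    \sum_(k.+1 <= n' < n) `[< n' < n /\ cut k.+1 n' s >] = i)).
    move=> s; suff -> : \sum_(k.+1 <= n' < n) `[< n' < n /\ cut k.+1 n' s >] =
      \sum_(k.+1 <= n' < n) `[< cut k.+1 n' s >] by [].
    apply: eq_big_nat => n' /andP[_ n'n]; congr (nat_of_bool _).
    by apply/asboolP/asboolP => [[]|].
  apply: borel_sum => n'.
  have [n'n|nn'] := ltnP n' n; last first.
    apply: (@borel_ext _ _ (fun=> False)); last exact: borel_const.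
    by move=> s; split=> // -[].
  apply: (borel_and hB); first exact: borel_const.
  by apply: borel_separated_nearby; apply: IH; lia.
by move=> A bA; apply: (bc (collapse n k.+1 @^-1` A)); apply: IH => //; lia.
Qed.

Lemma collapse_moves n k : exists L : seq M, forall x, exists2 a, a \in L &
  collapse n k x = act a x.
Proof.
have [d] : exists d, n.+1 - k <= d by exists (n.+1 - k).
elim: d n k => [|d IH] n k hd.
  by exists [:: 0%R] => x; exists 0%R; rewrite ?inE // collapse_id ?hact.1 //; lia.
have [kn|nk] := leqP k n; last first.
  by exists [:: 0%R] => x; exists 0%R; rewrite ?inE // collapse_id ?hact.1.
have [|L hL] := IH n k.+1; first lia.
exists [seq (a + b)%R | a <- L, b <- sc_moves (sc k)] => x.
have [b [bL _ E]] := center_moves k (rank k n) x.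
have [a aL E'] := hL (act b x).
by exists (a + b)%R; [exact: allpairs_f|rewrite collapseE // E E' hact.2].
Qed.

End Hierarchy.

(** * Hyperfiniteness *)

Section Hyperfinite.
Variables (M : countNmodType) (X : Type) (B : set (set X)) (act : M -> X -> X).
Variable V : nat -> set X.
Hypothesis S : borel_system B act V.
Let hB := bs_sigma S.
Let hact := bs_act S.

Lemma collapses_exist : exists G : nat -> X -> X,
  [/\ forall n, borel_map B (G n),
      forall n, exists L : seq M, forall x, exists2 a, a \in L & G n x = act a x &
      forall k e x y, joined act k e x y -> exists N, forall n, N <= n -> G n x = G n y].
Proof.
have /choice[scf hscf] : forall p : nat * nat, exists sc : scale M X,
    0 < p.2 -> good_scale B act p.1 p.2 sc.
  move=> [k r]; have [r0|] := posnP r; last first.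
    by move=> /(good_scale_exists k S) [sc h]; exists sc.
  by have [sc h] := good_scale_exists k S (ltn0Sn 0); exists sc; rewrite /= r0.
pose r k d := ((8 ^ k.+1).+1).+1 * (2 * d).+1.
(* the first component is the drift, the second one is delta *)
pose st := fix st k : nat * nat := if k is k'.+1 then
    let R := sc_reach (scf (k', r k' (st k').2)) in
    ((st k').1 + R, (st k').1 + 3 * R + k'.+1) else (0, 0).
pose sc k := scf (k, r k (st k).2).
have good k : good_scale B act k (r k (st k).2) (sc k) by apply: (hscf (k, r k (st k).2)); rewrite /= /r muln_gt0.
have h1 k : 3 * sc_reach (sc k) <= (st k.+1).2 by rewrite /= /sc; lia.
have h2 k : (st k).1 + k <= (st k).2 by case: k => //= k; lia.
have h3 k : (st k.+1).1 = (st k).1 + sc_reach (sc k) by [].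
pose rE k : r k (st k).2 = ((8 ^ k.+1).+1).+1 * (2 * (st k).2).+1 := erefl.
pose G n := collapse (fun k => (st k).2) good n 0.
exists G; split.
- by move=> n; apply: (borel_collapse S).
- by move=> n; apply: (collapse_moves S).
- by move=> k e x y xy; exact: (collapse_near S good rE h1 h2 h3 xy).
Qed.

Lemma orbit_equivalence_joined x y :
  orbit_equivalence act x y <-> exists k e, joined act k e x y.
Proof.
split=> [|[k [e [a [b [_ _ ab]]]]]].
  elim=> {x y} [x y [m ->]|x|x y _ [k [e h]]|x y z _ [k [e h]] _ [k' [e' h']]].
  - by have [k [e hm]] := in_cube_gen m; exists k, e; exact: joined_act.
  - by exists 0, 0; exact: joined_refl.
  - by exists k, e; exact: joined_sym.
  - exists (maxn k k'), (e + e'); apply: (joined_trans hact (y := y)).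
      by apply: joinedW h; rewrite ?leq_maxl.
    by apply: joinedW h'; rewrite ?leq_maxr.
apply: (Relation_Operators.rst_trans _ _ _ (act a x)).
  by apply: Relation_Operators.rst_step; exists a.
by apply: Relation_Operators.rst_sym; apply: Relation_Operators.rst_step; exists b.
Qed.

Let prodB : set (set (X * X)) := <<s [set A1 `*` A2 | A1 in B & A2 in B] >>.

Lemma prodB_sigma : sigma_algebra setT prodB.
Proof. exact: smallest_sigma_algebra. Qed.

(** The sets [V j] separate points, so equality is tested by countably many rectangles. *)
Lemma borel_rel_agree (f g : X -> X) : borel_map B f -> borel_map B g ->
  prodB [set p | f p.1 = g p.2].
Proof.
move=> bf bg.
apply: (@borel_ext _ prodB (fun p : X * X => forall j, V j (f p.1) -> V j (g p.2))).
  by move=> p; split; [exact: (bs_sep S)|move=> ->].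
apply: (borel_forall prodB_sigma) => j; apply: (borel_imply prodB_sigma).
- apply: sub_gen_smallest; exists (f @^-1` V j); first exact: bf _ (bs_V S j).
  exists setT; first exact: (borelT hB).
  by apply/seteqP; split=> -[a b] //= [].
- apply: sub_gen_smallest; exists setT; first exact: (borelT hB).
  exists (g @^-1` V j); first exact: bg _ (bs_V S j).
  by apply/seteqP; split=> -[a b] //= [].
Qed.

Lemma orbit_equivalence_meet x y :
  orbit_equivalence act x y <-> exists a b, act a x = act b y.
Proof.
rewrite orbit_equivalence_joined; split=> [[k [e [a [b [_ _ ab]]]]]|[a [b ab]]].
  by exists a, b.
have [k [e ha]] := in_cube_gen a; have [k' [e' hb]] := in_cube_gen b.
exists (maxn k k'), (maxn e e'), a, b; split=> //.
  by apply: in_cubeW ha; rewrite leq_maxl.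
by apply: in_cubeW hb; rewrite leq_maxr.
Qed.

Theorem orbit_equivalence_hyperfinite :
  (forall m y, finite_set (act m @^-1` [set y])) ->
  hyperfinite B (orbit_equivalence act).
Proof.
move=> fin; have [G [bG GL GE]] := collapses_exist.
split.
- split.
    split=> [x|x y z|x y]; first exact: Relation_Operators.rst_refl.
      exact: Relation_Operators.rst_trans.
    exact: Relation_Operators.rst_sym.
  apply: (@borel_ext _ prodB (fun p : X * X => exists a b, act a p.1 = act b p.2)).
    by move=> p; rewrite orbit_equivalence_meet.
  apply: (borel_exists prodB_sigma) => a; apply: (borel_exists prodB_sigma) => b.
  by apply: borel_rel_agree; exact: (bs_borel S).
- move=> x; apply: (@sub_countable _ _ _
    (\bigcup_(p in [set: M * M]) (act p.2 @^-1` [set act p.1 x]))).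
    apply: subset_card_le => y /= /orbit_equivalence_meet[a [b ab]].
    by exists (a, b).
  by apply: bigcup_countable => // p _; apply: finite_set_countable; exact: fin.
- exists (fun N x y => forall n, N <= n -> G n x = G n y); split.
  + move=> N; split.
      split=> [x|x y z xy yz n Nn|x y xy n Nn] //; last by rewrite xy.
      by rewrite xy // yz.
    apply: (borel_forall prodB_sigma) => n; apply: (borel_imply prodB_sigma).
      exact: (borel_const prodB_sigma).
    exact: borel_rel_agree.
  + move=> N x; have [L hL] := GL N.
    apply: (@sub_finite_set _ _ (\bigcup_(a in [set` L]) (act a @^-1` [set G N x]))).
      move=> y /= /(_ N (leqnn N)) E; have [a aL Ea] := hL y.
      by exists a => //=; rewrite -Ea.
    by apply: bigcup_finite => [|a _]; [exact: finite_seq|exact: fin].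
  + by move=> N x y h n Nn; apply: h; exact: ltnW.
  + move=> x y; split.
      by move=> /orbit_equivalence_joined[k [e /GE]].
    move=> [N /(_ N (leqnn N)) E]; have [L hL] := GL N.
    have [[a _ Ea] [b _ Eb]] := (hL x, hL y).
    by apply/orbit_equivalence_meet; exists a, b; rewrite -Ea -Eb.
Qed.

End Hyperfinite.

Theorem corollary1p3 (R : realType) (M : countNmodType)
    (X : Type) (B : set (set X)) (hX : standard_borel R B)
    (act : M -> X -> X) (hact : monoid_action act)
    (hborel : borel_action act B) (hbounded : bounded_to_one act) :
  hyperfinite B (orbit_equivalence act).
Proof.
have [[V [bV sepV]] _] := standard_borel_code hX.
apply: (@orbit_equivalence_hyperfinite M X B act V).
  split=> //; first exact: standard_borel_sigma_algebra hX.
    move=> m A bA; have [k hk] := hbounded m.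
    exact: standard_borel_image hX (hborel m) hk bA.
  by move=> m; have [k hk] := hbounded m; exists k => y; exact: fiber_code_of_card.
by move=> m y; have [k hk] := hbounded m; apply/finite_set_leP; exists k.
Qed.
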